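(* Let $p\ge 1$ and let $X_1,\dots,X_n$ be points of the tree space $\mathcal{T}_{p+2}$ (a sample from some density). Suppose that the log-likelihood $l(g)=\sum_{i=1}^n\log g(X_i)$ has a maximizer in $\bar{\mathcal{F}}_0$. Then this maximizer is unique $\nu$-almost everywhere: if $f_1,f_2\in\bar{\mathcal{F}}_0$ both maximize $l$ over $\bar{\mathcal{F}}_0$, then $f_1=f_2$ $\nu$-a.e.
   Context: $\mathcal{T}_{p+2}$ is the Billera–Holmes–Vogtmann space of metric phylogenetic trees with $p+3$ labelled leaves (one of them a root): it is the union of $(2p+1)!!$ closed nonnegative orthants $\mathbb{R}_{\ge 0}^{p}$, one for each binary tree topology, whose coordinates are the lengths of the $p$ internal edges (splits) of that topology; orthants are glued along common faces corresponding to shared splits (a face where some coordinates are zero represents the non-binary tree obtained by contracting those edges), and the point with all coordinates zero is the origin. It carries the induced intrinsic (geodesic) metric $d$, under which it is a Hadamard (CAT(0)) space. The measure $\nu$ is defined by $\nu(A)=\sum_i\nu_B(A_i)$, where $A_i$ is the part of $A$ in the interior of the $i$-th orthant and $\nu_B$ is Lebesgue measure on $\mathbb{R}^p$ (so the union of orthant boundaries has measure zero), completed. Concavity on a Hadamard space: a function $\phi:\mathcal{T}_{p+2}\to[-\infty,\infty]$ is concave if its hypograph $\{(x,\mu):\mu\le\phi(x)\}$ is a convex subset of $\mathcal{T}_{p+2}\times\mathbb{R}$, i.e. contains the unique geodesic between any two of its points. A probability density $g$ (w.r.t. $\nu$) is log-concave if $\log g$ (with $\log 0=-\infty$) is concave.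 $\bar{\mathcal{F}}_0$ is the set of upper-semicontinuous log-concave probability densities with respect to $\nu$ on $\mathcal{T}_{p+2}$. *)

(* Defs.v *)
From HB Require Import structures.
From mathcomp Require Import all_boot all_order all_algebra.
From mathcomp Require Import all_classical all_reals all_analysis.
Set Implicit Arguments. Unset Strict Implicit. Unset Printing Implicit Defensive.
Import Order.TTheory GRing.Theory Num.Theory.
Local Open Scope classical_set_scope.
Local Open Scope ring_scope.

Section Metric.
Variables (R : realType) (M : Type) (dist : M -> M -> R).

Definition geodesic (a b : M) (c : R -> M) : Prop :=
  c 0 = a /\ c (dist a b) = b /\
  forall s t, 0 <= s <= dist a b -> 0 <= t <= dist a b ->
    dist (c s) (c t) = `|s - t|.

Definition geod_convex (C : set M) : Prop :=
  forall a b, C a -> C b -> forall c, geodesic a b c ->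
    forall t, 0 <= t <= dist a b -> C (c t).
End Metric.

Definition prod_dist (R : realType) (M : Type) (dist : M -> M -> R)
  (u v : M * R) : R := Num.sqrt (dist u.1 v.1 ^+ 2 + (u.2 - v.2) ^+ 2).

(* BHV tree space T_{p+2}: leaves 'I_(p+3), leaf ord0 is the root.           *)
(* A split (internal edge) is represented by its side not containing the     *)
(* root, a clade A with 2 <= #|A| and 2 <= #|~: A|.                          *)
Definition is_split (p : nat) (A : {set 'I_(p.+3)}) : bool :=
  [&& (ord0 \notin A), (2 <= #|A|)%N & (2 <= #|~: A|)%N].

Definition split (p : nat) := {A : {set 'I_(p.+3)} | is_split A}.

(* compatibility of splits (for clades avoiding the root) *)
Definition compat (p : nat) (s t : split p) : bool :=
  [|| (val s \subset val t), (val t \subset val s) | [disjoint val s & val t]].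

(* maximal pairwise compatible sets of splits = binary topologies = orthants *)
Definition maxcompat (p : nat) (S : {set split p}) : bool :=
  [forall s in S, forall t in S, compat s t] &&
  [forall t, [forall s in S, compat s t] ==> (t \in S)].

(* a point of tree space: nonnegative edge lengths on a compatible support *)
Definition istree (R : realType) (p : nat) (x : {ffun split p -> R}) : bool :=
  [forall s, 0 <= x s] &&
  [forall s, forall t, ((x s != 0) && (x t != 0)) ==> compat s t].

Definition tree (R : realType) (p : nat) := {x : {ffun split p -> R} | istree x}.

Definition origin_is_tree (R : realType) (p : nat) :
  istree ([ffun => 0] : {ffun split p -> R}).
Proof.
apply/andP; split; apply/forallP => s; rewrite ffunE //.
by apply/forallP => t; rewrite eqxx.
Qed.

Definition origin (R : realType) (p : nat) : tree R p :=
  exist (fun x : {ffun split p -> R} => istree x) _ (origin_is_tree R p).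

Section TreeSpace.
Variables (R : realType) (p : nat).

Definition supp (x : tree R p) : {set split p} := [set s | val x s != 0].

Definition same_orthant (x y : tree R p) : bool :=
  [exists S : {set split p},
     [&& maxcompat S, supp x \subset S & supp y \subset S]].

Definition eucl (x y : tree R p) : R :=
  Num.sqrt (\sum_(s : split p) (val x s - val y s) ^+ 2).

(* intrinsic (geodesic) metric: infimum of lengths of piecewise-linear paths
   x = z_0, z_1, ..., z_k = y, each segment inside a single orthant *)
Definition tree_dist (x y : tree R p) : R :=
  inf [set l : R | exists zs : seq (tree R p),
         [/\ path same_orthant x zs, last x zs = y &
             l = \sum_(e <- pairmap eucl x zs) e]].

Definition chart (S : {set split p}) (v : #|S|.-tuple R) : tree R p :=
  insubd (origin R p)
    [ffun s => if s \in S then Num.max 0 (nth 0 v (index s (enum S))) else 0].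

Definition posorth (n : nat) : set (n.-tuple R) :=
  [set v | forall i : 'I_n, 0 < tnth v i].

(* iterated integral w.r.t. Lebesgue measure on R^n (= integral w.r.t. the
   n-fold product of Lebesgue measure, for nonnegative measurable f) *)
Fixpoint intn (n : nat) : (n.-tuple R -> \bar R) -> \bar R :=
  match n with
  | 0 => fun f => f [tuple]
  | n'.+1 => fun f =>
      (\int[@lebesgue_measure R]_x intn (fun t => f (cons_tuple x t)))%E
  end.

Definition nu_int (g : tree R p -> R) : \bar R :=
  (\sum_(S : {set split p} | maxcompat S)
     intn (fun v : #|S|.-tuple R =>
             if `[< posorth v >] then (g (chart v))%:E else 0%E))%E.

Definition nu (M : set (tree R p)) : \bar R := nu_int (\1_M).

Definition nu_measurable (M : set (tree R p)) : Prop :=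
  forall S : {set split p}, maxcompat S ->
    measurable [set v : #|S|.-tuple R | posorth v /\ M (chart v)].

Definition nu_measurable_fun (g : tree R p -> R) : Prop :=
  forall S : {set split p}, maxcompat S ->
    measurable_fun (@posorth #|S|) (fun v => g (chart v)).

(* P holds nu-almost everywhere (w.r.t. the completion of nu) *)
Definition nu_ae (P : tree R p -> Prop) : Prop :=
  exists M, [/\ nu_measurable M, nu M = 0%E & forall x, ~ P x -> M x].

Definition prob_density (g : tree R p -> R) : Prop :=
  [/\ forall x, 0 <= g x, nu_measurable_fun g & nu_int g = 1%E].

Definition logE (r : R) : \bar R := if 0 < r then (ln r)%:E else -oo%E.

Definition hypograph (phi : tree R p -> \bar R) : set (tree R p * R) :=
  [set z | (z.2%:E <= phi z.1)%E].

Definition concave (phi : tree R p -> \bar R) : Prop :=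
  geod_convex (prod_dist tree_dist) (hypograph phi).

Definition log_concave (g : tree R p -> R) : Prop :=
  concave (fun x => logE (g x)).

Definition usc (g : tree R p -> R) : Prop :=
  forall x a, g x < a -> exists2 e : R, 0 < e &
    forall y, tree_dist x y < e -> g y < a.

Definition F0bar (g : tree R p -> R) : Prop :=
  [/\ prob_density g, usc g & log_concave g].

Definition loglik (n : nat) (X : 'I_n -> tree R p) (g : tree R p -> R) : \bar R :=
  (\sum_(i < n) logE (g (X i)))%E.

Definition is_mle (n : nat) (X : 'I_n -> tree R p) (f : tree R p -> R) : Prop :=
  F0bar f /\ forall g, F0bar g -> (loglik X g <= loglik X f)%E.

End TreeSpace.

(* Main.v *)
Require Import Defs.
From HB Require Import structures.
From mathcomp Require Import all_boot all_order all_algebra.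
From mathcomp Require Import all_classical all_reals all_analysis.
From mathcomp Require Import measurable_realfun.
From mathcomp Require Import ring lra.
(* Reimported because [fintype.split] shadows [split]. *)
Import Defs.
Set Implicit Arguments. Unset Strict Implicit. Unset Printing Implicit Defensive.
Import Order.TTheory GRing.Theory Num.Theory.
Import numFieldNormedType.Exports.
Local Open Scope classical_set_scope.
Local Open Scope ring_scope.

(** Given two maximizers [f1], [f2], the normalization of [sqrt (f1 f2)] is
    again admissible, and if [c] is the integral of [sqrt (f1 f2)], its
    log-likelihood exceeds the maximum by [- n ln c].  Hence [c >= 1]; since
    [2 sqrt (f1 f2) = f1 + f2 - (sqrt f1 - sqrt f2)^2], this forces [f1 = f2]
    almost everywhere.

    For this [c] must be positive.  Let [K] be a superlevel set of [f2]
    containing the sample.  If [f1] did not vanish almost everywhere outside [K],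
    then the normalization of [f1 exp (- d (., K))] would beat [f1]; so [f2 > 0]
    almost everywhere on the support of [f1].  That this competitor is log-concave
    means that [d (., K)] is convex, for which the nonpositive curvature of tree
    space is needed.  It is proved by Reshetnyak gluing: the trees with splits in
    [s |: W] are those with splits in [W], glued with the product of [[0, oo[] and
    the trees with splits in [W] compatible with [s].

    Finally, the maximal likelihood is finite because uniform densities on large
    boxes are admissible, coordinates being convex along geodesics. *)

(** * Planar comparison *)

Section Planar.
Variable R : realType.
Implicit Types a b c s t : R.

Lemma ler_of_sqr a b : 0 <= b -> a ^+ 2 <= b ^+ 2 -> a <= b.
Proof. by move=> b0; case: (leP 0 a) => a0; [rewrite ler_pXn2r|lra]. Qed.

Lemma le_tangent s u q : 0 < s -> 0 <= q -> q ^+ 2 <= s ^+ 2 + u * (2 * s) ->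
  q <= s + u.
Proof.
move=> s0 q0 h; have su : 0 <= s + 2 * u by nra.
by apply: ler_of_sqr; nra.
Qed.

Lemma cos_sum_ge0 (u1 u2 v1 v2 : R) : 0 <= u2 -> 0 <= v2 ->
  u1 ^+ 2 + u2 ^+ 2 = 1 -> v1 ^+ 2 + v2 ^+ 2 = 1 -> 0 <= u1 + v1 ->
  0 <= u1 * v2 + v1 * u2.
Proof.
wlog uv : u1 u2 v1 v2 / v1 <= u1.
  move=> H u20 v20 hu hv huv; case: (leP v1 u1) => h; first exact: H.
  by rewrite addrC; apply: H => //; [exact: ltW|rewrite addrC].
move=> u20 v20 hu hv huv; case: (leP 0 v1) => h.
  by rewrite addr_ge0 // mulr_ge0 //; lra.
have : u2 <= v2 by apply: ler_of_sqr => //; nra.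
by move=> ?; nra.
Qed.

(* The point at distance [rho] from the vertex is where the segment joining
   the two sides of lengths [s] and [r] of an angle crosses the ray splitting
   it into two angles with cosines [c1], [c2] and sines [S1], [S2]. *)
Lemma hinge_crossing (c1 S1 c2 S2 s r : R) : 0 < s -> 0 < r ->
  0 <= S1 -> 0 <= S2 -> c1 ^+ 2 + S1 ^+ 2 = 1 -> c2 ^+ 2 + S2 ^+ 2 = 1 ->
  0 < c1 \/ 0 < c2 -> 0 <= c1 * S2 + c2 * S1 ->
  exists2 rho, 0 <= rho & forall d1 d2, 0 <= d1 -> 0 <= d2 ->
    d1 ^+ 2 <= s ^+ 2 + rho ^+ 2 - 2 * s * rho * c1 ->
    d2 ^+ 2 <= rho ^+ 2 + r ^+ 2 - 2 * rho * r * c2 ->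
    (d1 + d2) ^+ 2 <= s ^+ 2 + r ^+ 2 - 2 * s * r * (c1 * c2 - S1 * S2).
Proof.
move=> s0 r0 S10 S20 h1 h2 c12 h.
have [z|nz] := eqVneq (s * S1 + r * S2) 0.
  have S1z : S1 = 0 by nra.
  have S2z : S2 = 0 by nra.
  subst S1 S2; have hc1 : c1 = 1 \/ c1 = -1.
    have : (c1 - 1) * (c1 + 1) = 0 by nra.
    by move/eqP; rewrite mulf_eq0 => /orP[] /eqP ?; [left|right]; lra.
  have hc2 : c2 = 1 \/ c2 = -1.
    have : (c2 - 1) * (c2 + 1) = 0 by nra.
    by move/eqP; rewrite mulf_eq0 => /orP[] /eqP ?; [left|right]; lra.
  case: hc1 => hc1; case: hc2 => hc2; subst c1 c2.
  - exists s; first exact: ltW.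
    move=> d1 d2 d10 d20 e1 e2; have d1z : d1 = 0 by nra.
    by subst d1; nra.
  - exists s; first exact: ltW.
    move=> d1 d2 d10 d20 e1 e2; have d1z : d1 = 0 by nra.
    by subst d1; nra.
  - exists r; first exact: ltW.
    move=> d1 d2 d10 d20 e1 e2; have d2z : d2 = 0 by nra.
    by subst d2; nra.
  - by case: c12; lra.
have pz : 0 < s * S1 + r * S2.
  by rewrite lt_def nz addr_ge0 // mulr_ge0 // ltW.
set w := s * S1 + r * S2 in nz pz.
set E := s ^+ 2 + r ^+ 2 - 2 * s * r * (c1 * c2 - S1 * S2).
have EE : E = (s * c1 - r * c2) ^+ 2 + w ^+ 2.
  rewrite /E /w; transitivity (s ^+ 2 * (c1 ^+ 2 + S1 ^+ 2) +
    r ^+ 2 * (c2 ^+ 2 + S2 ^+ 2) - 2 * s * r * (c1 * c2 - S1 * S2)).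
    by rewrite h1 h2; ring.
  ring.
have E0 : 0 <= E by rewrite EE addr_ge0 // sqr_ge0.
set rho := s * r * (c1 * S2 + c2 * S1) / w.
have rho0 : 0 <= rho by apply: divr_ge0 (ltW pz); apply: mulr_ge0 => //; nra.
exists rho => // d1 d2 d10 d20 e1 e2.
set la := s * S1 / w.
have la0 : 0 <= la by apply: divr_ge0 (ltW pz); nra.
have la1 : 1 - la = r * S2 / w by rewrite /la /w; field.
have la10 : 0 <= 1 - la by rewrite la1; apply: divr_ge0 (ltW pz); nra.
have d1E : d1 ^+ 2 <= la ^+ 2 * E.
  apply: le_trans e1 _; rewrite le_eqVlt; apply/orP; left; apply/eqP.
  transitivity ((s * c1 - rho) ^+ 2 + (s * S1) ^+ 2).
    transitivity (s ^+ 2 * (c1 ^+ 2 + S1 ^+ 2) + rho ^+ 2 - 2 * s * rho * c1).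
      by rewrite h1; ring.
    ring.
  by rewrite EE /rho /la /w; field.
have d2E : d2 ^+ 2 <= (1 - la) ^+ 2 * E.
  apply: le_trans e2 _; rewrite le_eqVlt; apply/orP; left; apply/eqP.
  transitivity ((r * c2 - rho) ^+ 2 + (r * S2) ^+ 2).
    transitivity (r ^+ 2 * (c2 ^+ 2 + S2 ^+ 2) + rho ^+ 2 - 2 * rho * r * c2).
      by rewrite h2; ring.
    ring.
  by rewrite la1 EE /rho /w; field.
have [q q0 qE] : exists2 q, 0 <= q & E = q ^+ 2.
  by exists (Num.sqrt E); rewrite ?sqrtr_ge0 // sqr_sqrtr.
rewrite qE -!exprMn in d1E d2E *.
have f1 : d1 <= la * q by apply: ler_of_sqr => //; rewrite mulr_ge0.
have f2 : d2 <= (1 - la) * q by apply: ler_of_sqr => //; rewrite mulr_ge0.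
have f3 : d1 + d2 <= q by lra.
by rewrite ler_pXn2r // nnegrE addr_ge0.
Qed.

Lemma hinge_add_planar (c Ly Lw e f c1 S1 c2 S2 : R) :
  0 < c -> 0 < Ly -> 0 < Lw -> 0 < e -> 0 < f -> 0 <= S1 -> 0 <= S2 ->
  c1 ^+ 2 + S1 ^+ 2 = 1 -> c2 ^+ 2 + S2 ^+ 2 = 1 ->
  e ^+ 2 = Ly ^+ 2 + c ^+ 2 - 2 * Ly * c * c1 ->
  f ^+ 2 = Lw ^+ 2 + c ^+ 2 - 2 * Lw * c * c2 ->
  (e + f) * c ^+ 2 <= f * Ly ^+ 2 + e * Lw ^+ 2 - e * f * (e + f) ->
  [/\ 0 < c1 \/ 0 < c2, 0 <= c1 * S2 + c2 * S1 &
    Ly ^+ 2 + Lw ^+ 2 - (e + f) ^+ 2 <= 2 * Ly * Lw * (c1 * c2 - S1 * S2)].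
Proof.
move=> c0 Ly0 Lw0 e0 f0 S10 S20 h1 h2 he hf hS.
have key : 0 <= f * (Ly * c1 - c) + e * (Lw * c2 - c).
  rewrite -(pmulr_rge0 _ (_ : 0 < 2 * c)); last lra.
  have -> : 2 * c * (f * (Ly * c1 - c) + e * (Lw * c2 - c)) =
    f * (2 * Ly * c * c1) + e * (2 * Lw * c * c2) - 2 * (e + f) * c ^+ 2 by ring.
  have -> : 2 * Ly * c * c1 = Ly ^+ 2 + c ^+ 2 - e ^+ 2 by lra.
  have -> : 2 * Lw * c * c2 = Lw ^+ 2 + c ^+ 2 - f ^+ 2 by lra.
  by rewrite -subr_ge0 in hS; apply: le_trans hS _; rewrite le_eqVlt;
    apply/orP; left; apply/eqP; ring.
have eE : (Ly * c1 - c) ^+ 2 + (Ly * S1) ^+ 2 = e ^+ 2.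
  by rewrite he; have := congr1 (fun z => Ly ^+ 2 * z) h1; rewrite /=; lra.
have fE : (Lw * c2 - c) ^+ 2 + (Lw * S2) ^+ 2 = f ^+ 2.
  by rewrite hf; have := congr1 (fun z => Lw ^+ 2 * z) h2; rewrite /=; lra.
have en : e != 0 by rewrite gt_eqF.
have fn : f != 0 by rewrite gt_eqF.
split.
- case: (ltP 0 c1) => [|c1n]; first by left.
  right; case: (ltP 0 c2) => // c2n.
  have : Ly * c1 <= 0 by nra.
  have : Lw * c2 <= 0 by nra.
  by nra.
- have : 0 <= (Ly * c1 - c) / e * (Lw * S2 / f) + (Lw * c2 - c) / f * (Ly * S1 / e).
    apply: cos_sum_ge0.
    + by apply: divr_ge0 (ltW e0); nra.
    + by apply: divr_ge0 (ltW f0); nra.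
    + by rewrite !expr_div_n -mulrDl eE divff // expf_neq0.
    + by rewrite !expr_div_n -mulrDl fE divff // expf_neq0.
    + have -> : (Ly * c1 - c) / e + (Lw * c2 - c) / f =
        (f * (Ly * c1 - c) + e * (Lw * c2 - c)) / (e * f).
        by field; rewrite en fn.
      by apply: divr_ge0 => //; nra.
  have -> : (Ly * c1 - c) / e * (Lw * S2 / f) + (Lw * c2 - c) / f * (Ly * S1 / e) =
     (Ly * Lw * (c1 * S2 + c2 * S1) - c * (Lw * S2 + Ly * S1)) / (e * f).
     by field; rewrite en fn.
  rewrite pmulr_lge0 ?invr_gt0; last by nra.
  move=> h; have : 0 <= c * (Lw * S2 + Ly * S1) by apply: mulr_ge0; nra.
  move=> h'; have : 0 <= Ly * Lw * (c1 * S2 + c2 * S1) by lra.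
  by rewrite pmulr_rge0 //; nra.
- have cs : (Ly * c1 - c) * (c - Lw * c2) + (Ly * S1) * (Lw * S2) <= e * f.
    apply: ler_of_sqr; first nra.
    rewrite exprMn -eE -fE -subr_ge0.
    set p := Ly * c1 - c; set q := Ly * S1; set u := Lw * S2.
    have -> : Lw * c2 - c = - (c - Lw * c2) by ring.
    set v := c - Lw * c2.
    have -> : (p ^+ 2 + q ^+ 2) * ((- v) ^+ 2 + u ^+ 2) - (p * v + q * u) ^+ 2
       = (p * u - q * v) ^+ 2 by ring.
    exact: sqr_ge0.
  by nra.
Qed.

End Planar.

(** * Nonpositive curvature and gluing *)

Section Cat0.
Variables (R : realType) (M : Type) (d : M -> M -> R).
Hypothesis dxx : forall x, d x x = 0.
Hypothesis d_eq0 : forall x y, d x y = 0 -> x = y.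
Hypothesis dC : forall x y, d x y = d y x.
Hypothesis d_tri : forall y x z, d x z <= d x y + d y z.

Lemma dist_ge0 x y : 0 <= d x y.
Proof. by have := d_tri y x x; rewrite dxx (dC y x); lra. Qed.

Definition has_geod (X : set M) := forall x y r, X x -> X y -> 0 <= r <= d x y ->
  exists m, [/\ X m, d x m = r & d m y = d x y - r].

(* Stewart's relation with [<=], cleared of denominators. *)
Definition stewart (X : set M) := forall x y z m, X x -> X y -> X z -> X m ->
  d y m + d m z = d y z ->
  d y z * d x m ^+ 2 <= d m z * d x y ^+ 2 + d y m * d x z ^+ 2
                        - d y m * d m z * d y z.

Definition cat0 (X : set M) := has_geod X /\ stewart X.

Lemma cat0_uniq X x y m m' : stewart X -> X x -> X y -> X m -> X m' ->
  d x m + d m y = d x y -> d x m' + d m' y = d x y -> d x m = d x m' -> m = m'.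
Proof.
move=> S Xx Xy Xm Xm' h h' e.
have := S m' x y m Xm' Xx Xy Xm h.
have e2 : d m y = d m' y by lra.
rewrite (dC m' x) -e -e2 -h; move: (dist_ge0 x m) (dist_ge0 m y) => a0 b0.
have -> : d m y * d x m ^+ 2 + d x m * d m y ^+ 2 - d x m * d m y * (d x m + d m y)
   = 0 by ring.
have [z|nz] := eqVneq (d x m + d m y) 0.
  have ez : d x m = 0 by lra.
  by rewrite -(d_eq0 ez) -(d_eq0 (etrans (esym e) ez)).
have pz : 0 < d x m + d m y by rewrite lt_def nz addr_ge0.
rewrite pmulr_rle0 // => le0; symmetry; apply: d_eq0.
by have := sqr_ge0 (d m' m); nra.
Qed.

Definition hcos p x y := (d p x ^+ 2 + d p y ^+ 2 - d x y ^+ 2) / (2 * d p x * d p y).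

Lemma hcosC p x y : hcos p x y = hcos p y x.
Proof. by rewrite /hcos (dC x y) (addrC (_ ^+ 2)) -!mulrA (mulrC (d p x)). Qed.

Lemma hcosE p x y : 0 < d p x -> 0 < d p y ->
  2 * d p x * d p y * hcos p x y = d p x ^+ 2 + d p y ^+ 2 - d x y ^+ 2.
Proof. by move=> h1 h2; rewrite /hcos; field; rewrite !gt_eqF. Qed.

Lemma hcos_bound p x y : 0 < d p x -> 0 < d p y -> hcos p x y ^+ 2 <= 1.
Proof.
move=> h1 h2; have E := hcosE h1 h2.
have t1 := d_tri p x y; have t2 := d_tri x p y; have t3 := d_tri y p x.
rewrite (dC x p) in t1; rewrite (dC y x) in t3.
have P : 0 < 2 * d p x * d p y by nra.
have l1 : hcos p x y <= 1 by rewrite -(ler_pM2l P) E; nra.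
have l2 : -1 <= hcos p x y by rewrite -(ler_pM2l P) E; nra.
by nra.
Qed.

(* Two applications of Stewart's inequality compare a hinge with its Euclidean
   counterpart. *)
Lemma cat0_hinge X p x y q r : cat0 X -> X p -> X x -> X y -> X q -> X r ->
  0 < d p x -> 0 < d p y ->
  d p q + d q x = d p x -> d p r + d r y = d p y ->
  d q r ^+ 2 <= d p q ^+ 2 + d p r ^+ 2 - 2 * d p q * d p r * hcos p x y.
Proof.
move=> [_ S] Xp Xx Xy Xq Xr hx hy bq br.
have s1 := S y p x q Xy Xp Xx Xq bq.
have s2 := S q p y r Xq Xp Xy Xr br.
have E := hcosE hx hy.
rewrite (dC y q) (dC y p) (dC y x) in s1; rewrite (dC q p) in s2.
have P : 0 < d p x * d p y by nra.
rewrite -(ler_pM2l P); apply: le_trans (_ : _ <= d p x * (d r y * d p q ^+ 2 +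
  d p r * d q y ^+ 2 - d p r * d r y * d p y)) _.
  by rewrite -[leLHS]mulrA ler_pM2l.
have -> : d p x * d p y * (d p q ^+ 2 + d p r ^+ 2 - 2 * d p q * d p r * hcos p x y)
  = d p x * d p y * (d p q ^+ 2 + d p r ^+ 2) - d p q * d p r *
    (2 * d p x * d p y * hcos p x y) by ring.
rewrite E.
have := dist_ge0 p r; rewrite -subr_ge0 in s1 => r0.
have h := mulr_ge0 r0 s1; rewrite -subr_ge0.
apply: le_trans h _; rewrite le_eqVlt; apply/orP; left; apply/eqP.
have -> : d q x = d p x - d p q by lra.
have -> : d r y = d p y - d p r by lra.
ring.
Qed.

Section Glue.
Variables X1 X2 : set M.
Hypotheses (C1 : cat0 X1) (C2 : cat0 X2) (GA : has_geod (X1 `&` X2)).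
Hypothesis cross : forall x y, X1 x -> X2 y ->
  exists b, [/\ X1 b, X2 b & d x b + d b y = d x y].

Lemma convex_glue x m y : X1 x -> X1 y -> X2 m -> d x m + d m y = d x y -> X1 m.
Proof.
move=> Xx Xy Xm h.
have [b [b1 b2 hb]] := cross Xx Xm.
have [b' [b1' b2' hb']] := cross Xy Xm.
rewrite (dC y b') (dC b' m) (dC y m) in hb'.
have bb' : d b m + d m b' = d b b'.
  by have := d_tri b x y; have := d_tri b' b y; have := d_tri m b b'; lra.
have [|n [[n1 n2] n3 n4]] := GA (conj b1 b2) (conj b1' b2') (r := d b m).
  by rewrite dist_ge0 /= -bb'; have := dist_ge0 m b'; lra.
suff -> : m = n by [].
by apply: (cat0_uniq C2.2 b2 b2') => //; lra.
Qed.

Lemma cross_order x y b b' : X1 x -> X2 y -> X1 b -> X2 b -> X1 b' -> X2 b' ->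
  d x b + d b y = d x y -> d x b' + d b' y = d x y -> d x b <= d x b' ->
  d x b + d b b' = d x b'.
Proof.
move=> Xx Xy b1 b2 b1' b2' h h' le.
have [|n [[n1 n2] n3 n4]] := GA (conj b1 b2) (conj b1' b2') (r := d b b' / 2).
  by have := dist_ge0 b b'; lra.
have t1 := d_tri b x b'; have B0 := dist_ge0 b b'.
have [z|nz] := eqVneq (d b b') 0; first by lra.
have B1 : 0 < d b b' by rewrite lt_def nz.
have s1 := C1.2 x b b' n Xx b1 b1' n1 ltac:(lra).
have s2 := C2.2 y b b' n Xy b2 b2' n2 ltac:(lra).
rewrite n3 n4 in s1 s2.
have e1 : d x n ^+ 2 <= d x b ^+ 2 / 2 + d x b' ^+ 2 / 2 - d b b' ^+ 2 / 4.
  rewrite -(ler_pM2l B1); apply: le_trans s1 _; rewrite le_eqVlt; apply/orP; left.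
  by apply/eqP; field.
have e2 : d y n ^+ 2 <= d y b ^+ 2 / 2 + d y b' ^+ 2 / 2 - d b b' ^+ 2 / 4.
  rewrite -(ler_pM2l B1); apply: le_trans s2 _; rewrite le_eqVlt; apply/orP; left.
  by apply/eqP; field.
have t2 := d_tri n x y; rewrite (dC n y) in t2.
rewrite (dC b y) in h; rewrite (dC b' y) in h'.
have t3 := d_tri b' b y; have t4 := d_tri y b b'.
move: (dist_ge0 x n) (dist_ge0 y n) (dist_ge0 x b) (dist_ge0 y b')=> p1 p2 p3 p4.
apply/eqP; rewrite eq_le t1 andbT leNgt; apply/negP => lt.
set al := d x b in h le e1 lt p3 *; set al' := d x b' in h' le e1 lt *.
have eb : d y b = d x y - al by lra.
have eb' : d y b' = d x y - al' by lra.
rewrite eb eb' in e2 p4.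
have L1 : d x n < (al + al') / 2.
  rewrite ltNge; apply/negP => ge.
  have : ((al + al') / 2) ^+ 2 <= d x n ^+ 2 by apply: lerXn2r; rewrite ?nnegrE; lra.
  by nra.
have L2 : d y n <= d x y - (al + al') / 2.
  by apply: ler_of_sqr; nra.
lra.
Qed.

Lemma uniq_mixed11 x y m m' : X1 x -> X2 y -> X1 m -> X1 m' ->
  d x m + d m y = d x y -> d x m' + d m' y = d x y -> d x m = d x m' -> m = m'.
Proof.
move=> Xx Xy Xm Xm' h h' e.
have [b [b1 b2 hb]] := cross Xm Xy; have [b' [b1' b2' hb']] := cross Xm' Xy.
have t1 := d_tri m x b; have t2 := d_tri b x y.
have t1' := d_tri m' x b'; have t2' := d_tri b' x y.
have o : d x b + d b y = d x y by lra.
have o' : d x b' + d b' y = d x y by lra.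
case: (leP (d x b) (d x b')) => le.
  have c := cross_order Xx Xy b1 b2 b1' b2' o o' le.
  apply: (cat0_uniq C1.2 Xx b1') => //; try lra.
  by have := d_tri m x b'; have := d_tri b m b'; lra.
have c := cross_order Xx Xy b1' b2' b1 b2 o' o (ltW le).
apply: (cat0_uniq C1.2 Xx b1) => //; try lra.
by have := d_tri m' x b; have := d_tri b' m' b; lra.
Qed.

Lemma uniq_mixed12 x y m m' : X1 x -> X2 y -> X1 m -> X2 m' ->
  d x m + d m y = d x y -> d x m' + d m' y = d x y -> d x m = d x m' -> m = m'.
Proof.
move=> Xx Xy Xm Xm' h h' e.
have [b [b1 b2 hb]] := cross Xm Xy; have [b' [b1' b2' hb']] := cross Xx Xm'.
have t1 := d_tri m x b; have t2 := d_tri b x y.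
have t1' := d_tri b' x y; have t2' := d_tri m' b' y.
have o : d x b + d b y = d x y by lra.
have o' : d x b' + d b' y = d x y by lra.
have p := dist_ge0.
case: (leP (d x b) (d x b')) => le.
  have c := cross_order Xx Xy b1 b2 b1' b2' o o' le.
  have z1 : d m b = 0 by have := p m b; have := p b' m'; lra.
  have z2 : d b' m' = 0 by have := p m b; have := p b' m'; lra.
  have z3 : d b b' = 0 by have := p m b; have := p b' m'; lra.
  by rewrite (d_eq0 z1) (d_eq0 z3) (d_eq0 z2).
have c := cross_order Xx Xy b1' b2' b1 b2 o' o (ltW le).
have [|n [[n1 n2] n3 n4]] := GA (conj b1' b2') (conj b1 b2) (r := d x m - d x b').
  by have := p m b; have := p b' m'; lra.
have t3 := d_tri b' x n; have t4 := d_tri n x b; have t5 := d_tri n b' y.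
have t6 := d_tri b n y.
have -> : m = n by apply: (cat0_uniq C1.2 Xx b1) => //; lra.
by symmetry; apply: (cat0_uniq C2.2 b2' Xy) => //; lra.
Qed.

End Glue.

Lemma cross_sym (X1 X2 : set M) :
  (forall x y, X1 x -> X2 y -> exists b, [/\ X1 b, X2 b & d x b + d b y = d x y]) ->
  forall x y, X2 x -> X1 y -> exists b, [/\ X2 b, X1 b & d x b + d b y = d x y].
Proof.
move=> H x y Xx Xy; have [b [b1 b2 h]] := H _ _ Xy Xx.
by exists b; split=> //; rewrite (dC x b) (dC b y) (dC x y) addrC.
Qed.

Section Reshetnyak.
Variables X1 X2 : set M.
Hypotheses (C1 : cat0 X1) (C2 : cat0 X2) (GA : has_geod (X1 `&` X2)).
Hypothesis cross : forall x y, X1 x -> X2 y ->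
  exists b, [/\ X1 b, X2 b & d x b + d b y = d x y].

Let GA' : has_geod (X2 `&` X1). Proof. by rewrite setIC. Qed.
Let cross' := cross_sym cross.
Let U := X1 `|` X2.

Let conv1 x m y : X1 x -> X1 y -> U m -> d x m + d m y = d x y -> X1 m.
Proof. by move=> ? ? [//|Xm] h; exact: (convex_glue C2 GA cross _ _ Xm h). Qed.

Let conv2 x m y : X2 x -> X2 y -> U m -> d x m + d m y = d x y -> X2 m.
Proof. by move=> ? ? [Xm|//] h; exact: (convex_glue C1 GA' cross' _ _ Xm h). Qed.

Let uniq_mixed x y m m' : X1 x -> X2 y -> U m -> U m' ->
  d x m + d m y = d x y -> d x m' + d m' y = d x y -> d x m = d x m' -> m = m'.
Proof.
move=> Xx Xy Um Um' h h' e.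
have H1 := uniq_mixed11 C1 C2 GA cross Xx Xy.
have H2 := uniq_mixed12 C1 C2 GA cross Xx Xy.
have H3 := uniq_mixed11 C2 C1 GA' cross' Xy Xx.
case: Um => Xm; case: Um' => Xm'; first exact: H1.
- exact: H2.
- by symmetry; apply: H2.
- by apply: H3 => //; rewrite ?(dC y m) ?(dC y m') ?(dC m x) ?(dC m' x) ?(dC y x); lra.
Qed.

Lemma glue_uniq x y m m' : U x -> U y -> U m -> U m' ->
  d x m + d m y = d x y -> d x m' + d m' y = d x y -> d x m = d x m' -> m = m'.
Proof.
move=> [Xx|Xx] [Xy|Xy] Um Um' h h' e.
- by apply: (cat0_uniq C1.2 Xx Xy) => //; [apply: conv1 h|apply: conv1 h'].
- exact: (uniq_mixed Xx Xy).
- apply: (uniq_mixed Xy Xx) => //;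
  by rewrite ?(dC y m) ?(dC y m') ?(dC m x) ?(dC m' x) ?(dC y x); lra.
- by apply: (cat0_uniq C2.2 Xx Xy) => //; [apply: conv2 h|apply: conv2 h'].
Qed.

Let geod_mixed x y r : X1 x -> X2 y -> 0 <= r <= d x y ->
  exists m, [/\ U m, d x m = r & d m y = d x y - r].
Proof.
move=> Xx Xy r0; have [b [b1 b2 h]] := cross Xx Xy.
case: (leP r (d x b)) => le.
  have [|m [m1 m2 m3]] := C1.1 x b r Xx b1; first by lra.
  by exists m; split; [left|lra|have := d_tri b m y; have := d_tri m x y; lra].
have [|m [m1 m2 m3]] := C2.1 b y (r - d x b) b2 Xy; first by lra.
by exists m; split; [right|have := d_tri b x m; have := d_tri m x y; lra|lra].
Qed.

Lemma glue_geod : has_geod U.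
Proof.
move=> x y r [Xx|Xx] [Xy|Xy] r0.
- by have [m [? ? ?]] := C1.1 x y r Xx Xy r0; exists m; split=> //; left.
- exact: geod_mixed.
- have [|m [? e1 e2]] := geod_mixed (r := d x y - r) Xy Xx.
    by rewrite (dC y x); lra.
  by exists m; split=> //; rewrite ?(dC x m) ?(dC m y) ?e1 ?e2 ?(dC y x); lra.
- by have [m [? ? ?]] := C2.1 x y r Xx Xy r0; exists m; split=> //; right.
Qed.

Definition hinge p x y := 0 < d p x -> 0 < d p y -> forall s t, 0 < s -> 0 < t ->
  exists2 e0, 0 < e0 & forall e q r, 0 < e <= e0 -> U q -> U r ->
    d p q = e * s -> d p q + d q x = d p x -> d p r = e * t -> d p r + d r y = d p y ->
    d q r ^+ 2 <= e ^+ 2 * (s ^+ 2 + t ^+ 2 - 2 * s * t * hcos p x y).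

Lemma hingeC p x y : hinge p x y -> hinge p y x.
Proof.
move=> H py px s t s0 t0; have [e0 e00 h] := H px py t s t0 s0.
exists e0 => // e q r e1 Uq Ur q1 q2 r1 r2.
have := h e r q e1 Ur Uq r1 r2 q1 q2.
by rewrite (dC r q) hcosC (addrC (t ^+ 2)) (mulrAC 2 t s).
Qed.

Definition tri x y z := [/\ hinge x y z, hinge y x z & hinge z x y].

Lemma triC x y z : tri x y z -> tri y x z.
Proof. by case=> h1 h2 h3; split=> //; exact: hingeC. Qed.

Lemma triC' x y z : tri x y z -> tri x z y.
Proof. by case=> h1 h2 h3; split=> //; exact: hingeC. Qed.

Lemma hinge1 p x y : X1 p -> X1 x -> X1 y -> hinge p x y.
Proof.
move=> Xp Xx Xy px py s t s0 t0; exists 1; first by [].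
move=> e q r e1 Uq Ur q1 q2 r1 r2.
have := cat0_hinge C1 Xp Xx Xy (conv1 Xp Xx Uq q2) (conv1 Xp Xy Ur r2) px py q2 r2.
by rewrite q1 r1; move/le_trans; apply; rewrite le_eqVlt; apply/orP; left; apply/eqP; ring.
Qed.

Lemma hinge2 p x y : X2 p -> X2 x -> X2 y -> hinge p x y.
Proof.
move=> Xp Xx Xy px py s t s0 t0; exists 1; first by [].
move=> e q r e1 Uq Ur q1 q2 r1 r2.
have := cat0_hinge C2 Xp Xx Xy (conv2 Xp Xx Uq q2) (conv2 Xp Xy Ur r2) px py q2 r2.
by rewrite q1 r1; move/le_trans; apply; rewrite le_eqVlt; apply/orP; left; apply/eqP; ring.
Qed.

Lemma tri1 x y z : X1 x -> X1 y -> X1 z -> tri x y z.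
Proof. by split; exact: hinge1. Qed.

Lemma tri2 x y z : X2 x -> X2 y -> X2 z -> tri x y z.
Proof. by split; exact: hinge2. Qed.

(* The angles at [p] add up to at least pi, for otherwise cutting the corner
   at [p] would shorten the geodesic from [y] to [w]. *)
Lemma stewart_of_hinges x y p w : U x -> U y -> U p -> U w ->
  d y p + d p w = d y w -> hinge p x y -> hinge p x w ->
  d y w * d x p ^+ 2 <= d p w * d x y ^+ 2 + d y p * d x w ^+ 2
                        - d y p * d p w * d y w.
Proof.
move=> Ux Uy Up Uw h H1 H2.
have [/d_eq0 z|nyp] := eqVneq (d y p) 0.
  by rewrite z dxx !mul0r addr0 subr0.
have [/d_eq0 z|npw] := eqVneq (d p w) 0.
  by rewrite z dxx !(mul0r, mulr0) add0r subr0.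
have [/d_eq0 z|nxp] := eqVneq (d x p) 0.
  rewrite -h z dxx (dC p y) le_eqVlt; apply/orP; left; apply/eqP; ring.
have yp : 0 < d y p by rewrite lt_def nyp dist_ge0.
have pw : 0 < d p w by rewrite lt_def npw dist_ge0.
have xp : 0 < d p x by rewrite dC lt_def nxp dist_ge0.
have py : 0 < d p y by rewrite dC.
have cos_le0 : hcos p x y + hcos p x w <= 0.
  rewrite leNgt; apply/negP => pos; set S := _ + _ in pos.
  set t := S / 2; have t0 : 0 < t by rewrite /t; lra.
  have [e1 e10 K1] := H1 xp py t 1 t0 ltr01.
  have [e2 e20 K2] := H2 xp pw t 1 t0 ltr01.
  pose e := Num.min (Num.min e1 e2) (Num.min (d p x / t) (Num.min (d p y) (d p w))).
  have e0 : 0 < e by rewrite !lt_min e10 e20 py pw divr_gt0.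
  have le1 : e <= e1 by rewrite /e !ge_min lexx.
  have le2 : e <= e2 by rewrite /e !ge_min lexx !orbT.
  have lex : e * t <= d p x by rewrite -ler_pdivlMr // /e !ge_min lexx !orbT.
  have ley : e <= d p y by rewrite /e !ge_min lexx !orbT.
  have lew : e <= d p w by rewrite /e !ge_min lexx !orbT.
  have et0 : 0 < e * t by exact: mulr_gt0.
  have [|q [Uq q1 q2]] := glue_geod Up Ux (r := e * t); first by rewrite ltW.
  have [|u [Uu u1 u2]] := glue_geod Up Uy (r := e * 1); first by rewrite mulr1 ltW.
  have [|v [Uv v1 v2]] := glue_geod Up Uw (r := e * 1); first by rewrite mulr1 ltW.
  have k1 := K1 e q u ltac:(by rewrite e0) Uq Uu q1 ltac:(lra) u1 ltac:(lra).
  have k2 := K2 e q v ltac:(by rewrite e0) Uq Uv q1 ltac:(lra) v1 ltac:(lra).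
  rewrite mulr1 in u1 v1.
  have b1 : d q u <= e + e * (t ^+ 2 / 2 - t * hcos p x y).
    apply: le_tangent => //; first exact: dist_ge0.
    by apply: le_trans k1 _; rewrite le_eqVlt; apply/orP; left; apply/eqP; field.
  have b2 : d q v <= e + e * (t ^+ 2 / 2 - t * hcos p x w).
    apply: le_tangent => //; first exact: dist_ge0.
    by apply: le_trans k2 _; rewrite le_eqVlt; apply/orP; left; apply/eqP; field.
  have t1 := d_tri u y w; have t2 := d_tri v u w; have t3 := d_tri q u v.
  rewrite (dC y u) (dC u q) in t1 t3; rewrite (dC p y) in u2.
  have : 0 <= e * (t ^+ 2 - t * S) by rewrite /S; lra.
  rewrite pmulr_rge0 // /t; nra.
have E1 := hcosE xp py; have E2 := hcosE xp pw.
rewrite (dC x p) (dC x y) (dC x w) (dC y p) in E1 E2 * => //.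
rewrite (dC y p) in h.
have : 2 * d p x * d p y * d p w * (hcos p x y + hcos p x w) <= 0.
  by rewrite pmulr_rle0 // !mulr_gt0.
have -> : 2 * d p x * d p y * d p w * (hcos p x y + hcos p x w) =
  d p w * (2 * d p x * d p y * hcos p x y) + d p y * (2 * d p x * d p w * hcos p x w)
  by ring.
rewrite E1 E2 -h; nra.
Qed.

Lemma hinge_extend z b w y : U z -> U b -> U y -> 0 < d z b -> d z b + d b y = d z y ->
  d z y * d w b ^+ 2 <= d b y * d w z ^+ 2 + d z b * d w y ^+ 2 - d z b * d b y * d z y ->
  hinge z b w -> hinge z y w.
Proof.
move=> Uz Ub Uy zb h S H zy zw s t s0 t0.
have [e0 e00 K] := H zb zw s t s0 t0.
exists (Num.min e0 (d z b / s)); first by rewrite lt_min e00 divr_gt0.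
move=> e q r /andP[e1]; rewrite le_min => /andP[e2 e3] Uq Ur q1 q2 r1 r2.
have les : e * s <= d z b by rewrite -ler_pdivlMr.
have [|q' [Uq' q1' q2']] := glue_geod Uz Ub (r := e * s).
  by rewrite les andbT ltW // mulr_gt0.
have qq' : q = q'.
  apply: (glue_uniq Uz Uy) => //; try lra.
  by have := d_tri q' z y; have := d_tri b q' y; lra.
have {K} := K e q r ltac:(by rewrite e1) Uq Ur q1 ltac:(rewrite qq'; lra) r1 r2.
move/le_trans; apply; rewrite ler_pM2l ?exprn_gt0 // lerB // ler_pM2l; last first.
  by rewrite !mulr_gt0.
have P : 0 < 2 * d z b * d z y * d z w by rewrite !mulr_gt0.
rewrite -(ler_pM2l P).
have -> : 2 * d z b * d z y * d z w * hcos z y w = d z b * (2 * d z y * d z w * hcos z y w).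
  by ring.
have -> : 2 * d z b * d z y * d z w * hcos z b w = d z y * (2 * d z b * d z w * hcos z b w).
  by ring.
rewrite (hcosE zy zw) (hcosE zb zw) (dC y w) (dC b w).
rewrite (dC w z) in S; have e4 : d b y = d z y - d z b by lra.
by rewrite e4 in S; nra.
Qed.

Lemma hinge_add x y p w : U x -> U y -> U p -> U w -> 0 < d y p -> 0 < d p w ->
  d y p + d p w = d y w ->
  d y w * d x p ^+ 2 <= d p w * d x y ^+ 2 + d y p * d x w ^+ 2 - d y p * d p w * d y w ->
  hinge x y p -> hinge x p w -> hinge x y w.
Proof.
move=> Ux Uy Up Uw yp pw h S H1 H2 xy xw s t s0 t0.
have [/d_eq0 z|nxp] := eqVneq (d x p) 0.
  exists 1 => // e q r /andP[e0 _] Uq Ur q1 q2 r1 r2.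
  have -> : hcos x y w = -1.
    by rewrite /hcos z (dC p y) -h; field; rewrite !gt_eqF.
  have -> : e ^+ 2 * (s ^+ 2 + t ^+ 2 - 2 * s * t * -1) = (e * s + e * t) ^+ 2 by ring.
  apply: lerXn2r; rewrite ?nnegrE ?dist_ge0 //; first by nra.
  by have := d_tri x q r; rewrite (dC q x) q1 r1.
have xp : 0 < d x p by rewrite lt_def nxp dist_ge0.
have B1 := hcos_bound xy xp; have B2 := hcos_bound xp xw.
pose S1 := Num.sqrt (1 - hcos x y p ^+ 2); pose S2 := Num.sqrt (1 - hcos x p w ^+ 2).
have E1 : hcos x y p ^+ 2 + S1 ^+ 2 = 1 by rewrite sqr_sqrtr; lra.
have E2 : hcos x p w ^+ 2 + S2 ^+ 2 = 1 by rewrite sqr_sqrtr; lra.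
have S10 : 0 <= S1 by exact: sqrtr_ge0.
have S20 : 0 <= S2 by exact: sqrtr_ge0.
have [|||k1 k2 k3] := hinge_add_planar xp xy xw yp pw S10 S20 E1 E2.
- by have := hcosE xy xp; lra.
- by have := hcosE xp xw; lra.
- by rewrite h.
have [rho rho0 cr] := hinge_crossing s0 t0 S10 S20 E1 E2 k1 k2.
have le_cos : hcos x y w <= hcos x y p * hcos x p w - S1 * S2.
  have P : 0 < 2 * d x y * d x w by rewrite !mulr_gt0.
  by rewrite -(ler_pM2l P) (hcosE xy xw) -h.
have fin e q r dq dr : 0 < e -> 0 <= dq -> 0 <= dr -> d q r <= dq + dr ->
    (dq / e) ^+ 2 <= s ^+ 2 + rho ^+ 2 - 2 * s * rho * hcos x y p ->
    (dr / e) ^+ 2 <= rho ^+ 2 + t ^+ 2 - 2 * rho * t * hcos x p w ->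
    d q r ^+ 2 <= e ^+ 2 * (s ^+ 2 + t ^+ 2 - 2 * s * t * hcos x y w).
  move=> e0 dq0 dr0 le b1 b2.
  apply: le_trans (_ : _ <= (dq + dr) ^+ 2) _.
    by apply: lerXn2r; rewrite ?nnegrE ?dist_ge0 // addr_ge0.
  have -> : (dq + dr) ^+ 2 = e ^+ 2 * (dq / e + dr / e) ^+ 2.
    by field; rewrite gt_eqF.
  rewrite ler_pM2l ?exprn_gt0 //.
  apply: le_trans (cr _ _ _ _ b1 b2) _; try by rewrite divr_ge0 // ltW.
  by rewrite lerB // ler_pM2l // !mulr_gt0.
have [rz|nr] := eqVneq rho 0.
  exists 1 => // e q r /andP[e0 _] Uq Ur q1 q2 r1 r2.
  have en : e != 0 by rewrite gt_eqF.
  apply: (fin e q r (e * s) (e * t)) => //; try by rewrite ltW // mulr_gt0.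
  - by have := d_tri x q r; rewrite (dC q x) q1 r1.
  - by rewrite rz mulrAC divff // mul1r expr0n /= !(mulr0, mul0r); lra.
  - by rewrite rz mulrAC divff // mul1r expr0n /= !(mulr0, mul0r); lra.
have rp : 0 < rho by rewrite lt_def nr.
have [e1 e10 K1] := H1 xy xp s rho s0 rp.
have [e2 e20 K2] := H2 xp xw rho t rp t0.
exists (Num.min e1 (Num.min e2 (d x p / rho))).
  by rewrite !lt_min e10 e20 divr_gt0.
move=> e q r /andP[e0]; rewrite !le_min => /and3P[l1 l2 l3] Uq Ur q1 q2 r1 r2.
have ler : e * rho <= d x p by rewrite -ler_pdivlMr.
have [|n [Un n1 n2]] := glue_geod Ux Up (r := e * rho).
  by rewrite ler andbT ltW // mulr_gt0.
have en : e ^+ 2 != 0 by rewrite expf_neq0 // gt_eqF.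
have b1 := K1 e q n ltac:(by rewrite e0) Uq Un q1 q2 n1 ltac:(lra).
have b2 := K2 e n r ltac:(by rewrite e0) Un Ur n1 ltac:(lra) r1 r2.
apply: (fin e q r (d q n) (d n r)) => //; try exact: dist_ge0.
- by rewrite expr_div_n ler_pdivrMr ?exprn_gt0 // mulrC.
- by rewrite expr_div_n ler_pdivrMr ?exprn_gt0 // mulrC.
Qed.

Lemma glue_tri x y p w : U x -> U y -> U p -> U w -> d y p + d p w = d y w ->
  tri x y p -> tri x p w -> tri x y w.
Proof.
move=> Ux Uy Up Uw h T1 T2.
have [/d_eq0 -> //|nyp] := eqVneq (d y p) 0.
have [/d_eq0 <- //|npw] := eqVneq (d p w) 0.
have yp : 0 < d y p by rewrite lt_def nyp dist_ge0.
have pw : 0 < d p w by rewrite lt_def npw dist_ge0.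
case: (T1) => a1 a2 a3; case: (T2) => b1 b2 b3.
have S := stewart_of_hinges Ux Uy Up Uw h a3 b2.
split.
- exact: hinge_add yp pw h S a1 b1.
- by apply: hingeC; apply: (hinge_extend Uy Up Uw yp h) => //; apply: hingeC.
- apply: hingeC; apply: (hinge_extend Uw Up Uy _ _ _ (hingeC b3)).
  + by rewrite dC.
  + by rewrite (dC w p) (dC p y) (dC w y); lra.
  + by rewrite (dC w p) (dC p y) (dC w y); lra.
Qed.

Let tri_mixed (Y1 Y2 : set M) z y w :
  (forall u, Y1 u -> U u) -> (forall u, Y2 u -> U u) ->
  (forall a b c, Y1 a -> Y1 b -> Y1 c -> tri a b c) ->
  (forall a b c, Y2 a -> Y2 b -> Y2 c -> tri a b c) ->
  (forall x y, Y1 x -> Y2 y -> exists b, [/\ Y1 b, Y2 b & d x b + d b y = d x y]) ->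
  Y1 z -> Y2 y -> Y2 w -> tri z y w.
Proof.
move=> U1 U2 T1 T2 cr Yz Yy Yw.
have [b [b1 b2 hb]] := cr _ _ Yz Yy; have [b' [b1' b2' hb']] := cr _ _ Yz Yw.
have Tb : tri b z w.
  apply: (glue_tri (p := b')) => //; by [apply: U1|apply: U2|apply: T1|apply: T2].
apply: triC'; apply: triC.
apply: (glue_tri (p := b)) => //; try by [apply: U1|apply: U2|apply: T2].
by apply: triC'; apply: triC; apply: triC'.
Qed.

Lemma glue_tri_all x y z : U x -> U y -> U z -> tri x y z.
Proof.
have U1 u : X1 u -> U u by left.
have U2 u : X2 u -> U u by right.
have M1 a b c : X1 a -> X2 b -> X2 c -> tri a b c.
  by apply: (tri_mixed (Y1 := X1) (Y2 := X2)) => //; [exact: tri1|exact: tri2].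
have M2 a b c : X2 a -> X1 b -> X1 c -> tri a b c.
  by apply: (tri_mixed (Y1 := X2) (Y2 := X1)) => //; [exact: tri2|exact: tri1].
move=> [x1|x2] [y1|y2] [z1|z2].
- exact: tri1.
- by apply: triC'; apply: triC; apply: M2.
- by apply: triC; apply: M2.
- exact: M1.
- exact: M2.
- by apply: triC; apply: M1.
- by apply: triC'; apply: triC; apply: M1.
- exact: tri2.
Qed.

Theorem cat0_glue : cat0 U.
Proof.
split; first exact: glue_geod.
move=> x y z m Ux Uy Uz Um h.
apply: stewart_of_hinges => //.
- by case: (glue_tri_all Um Ux Uy).
- by case: (glue_tri_all Um Ux Uz).
Qed.

End Reshetnyak.

(** * Consequences of nonpositive curvature *)

Section Busemann.
Variable X : set M.
Hypothesis CX : cat0 X.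

Definition tpt t x y m := d x m = t * d x y /\ d m y = (1 - t) * d x y.

Lemma tpt_exists t x y : X x -> X y -> 0 <= t <= 1 -> exists2 m, X m & tpt t x y m.
Proof.
move=> Xx Xy t01; have d0 := dist_ge0 x y.
have [|m [Xm e1 e2]] := CX.1 x y (t * d x y) Xx Xy; first by nra.
by exists m => //; split=> //; rewrite e2; ring.
Qed.

Lemma tpt_sym t x y m : tpt t x y m -> tpt (1 - t) y x m.
Proof. by case=> e1 e2; split; rewrite (dC y x) ?(dC y m) ?(dC m x) ?e1 ?e2 //; ring. Qed.

Lemma tpt_uniq t x y m m' : X x -> X y -> X m -> X m' ->
  tpt t x y m -> tpt t x y m' -> m = m'.
Proof.
move=> Xx Xy Xm Xm' [e1 e2] [f1 f2].
by apply: (cat0_uniq CX.2 Xx Xy) => //; rewrite ?e1 ?e2 ?f1 ?f2; ring.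
Qed.

Lemma tpt_stewart t x y z m : X x -> X y -> X z -> X m -> 0 <= t <= 1 -> tpt t y z m ->
  d x m ^+ 2 <= (1 - t) * d x y ^+ 2 + t * d x z ^+ 2 - t * (1 - t) * d y z ^+ 2.
Proof.
move=> Xx Xy Xz Xm t01 [e1 e2].
have := CX.2 x y z m Xx Xy Xz Xm ltac:(rewrite e1 e2; ring).
have [z0|nz] := eqVneq (d y z) 0.
  have my : m = y by symmetry; apply: d_eq0; rewrite e1 z0 mulr0.
  have zy : z = y by symmetry; apply: d_eq0.
  by move=> _; rewrite my zy dxx le_eqVlt; apply/orP; left; apply/eqP; ring.
have P : 0 < d y z by rewrite lt_def nz dist_ge0.
move=> S; rewrite -(ler_pM2l P); apply: le_trans S _.
by rewrite e1 e2 le_eqVlt; apply/orP; left; apply/eqP; ring.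
Qed.

Lemma tpt_ratio s t x y m n : X x -> X y -> X m -> X n -> 0 <= s <= 1 -> 0 <= t <= 1 ->
  tpt s x y m -> tpt t x y n -> d m n = `|s - t| * d x y.
Proof.
move=> Xx Xy Xm Xn s01 t01 [e1 e2] tn; have [f1 f2] := tn.
have := tpt_stewart Xm Xx Xy Xn t01 tn; rewrite (dC m x) e1 e2.
have d0 := dist_ge0 x y; have p0 := dist_ge0 m n => h.
apply/eqP; rewrite eq_le; apply/andP; split.
  apply: ler_of_sqr; first by rewrite mulr_ge0.
  rewrite exprMn real_normK ?num_real //; apply: le_trans h _.
  by rewrite le_eqVlt; apply/orP; left; apply/eqP; ring.
have := d_tri m x n; have := d_tri n x m; rewrite (dC n m) e1 f1 => h1 h2.
by case: (ger0P (s - t)) => st; lra.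
Qed.

Lemma busemann_apex t z x y m n : X z -> X x -> X y -> X m -> X n -> 0 <= t <= 1 ->
  tpt t z x m -> tpt t z y n -> d m n <= t * d x y.
Proof.
move=> Xz Xx Xy Xm Xn t01 tm tn; have [e1 e2] := tm.
have s1 := tpt_stewart Xm Xz Xy Xn t01 tn.
have s2 := tpt_stewart Xy Xz Xx Xm t01 tm.
rewrite (dC m z) e1 (dC m y) in s1; rewrite (dC y z) (dC y x) in s2.
apply: ler_of_sqr; first by rewrite mulr_ge0 ?dist_ge0 //; lra.
by nra.
Qed.

Lemma busemann t x y x' y' m m' : X x -> X y -> X x' -> X y' -> X m -> X m' ->
  0 <= t <= 1 -> tpt t x y m -> tpt t x' y' m' ->
  d m m' <= (1 - t) * d x x' + t * d y y'.
Proof.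
move=> Xx Xy Xx' Xy' Xm Xm' t01 tm tm'.
have [n Xn tn] := tpt_exists Xx Xy' t01.
have b1 := busemann_apex Xx Xy Xy' Xm Xn t01 tm tn.
have b2 := busemann_apex Xy' Xx Xx' Xn Xm' (t := 1 - t) ltac:(lra) (tpt_sym tn) (tpt_sym tm').
by have := d_tri n m m'; lra.
Qed.

End Busemann.
End Cat0.

Section Pythagoras.
Variable R : realType.
Implicit Types t D : R.

Lemma sumsq_eq0 (a b : R) : a ^+ 2 + b ^+ 2 <= 0 -> a = 0.
Proof.
move=> h; apply/eqP; rewrite -sqrf_eq0; apply/eqP.
by have := sqr_ge0 a; have := sqr_ge0 b; lra.
Qed.

Lemma pythagoras_mid t D (p1 q1 X p2 q2 Y : R) : 0 <= t <= 1 -> 0 <= D ->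
  0 <= p1 -> 0 <= q1 -> 0 <= X -> 0 <= p2 -> 0 <= q2 -> 0 <= Y ->
  X <= p1 + q1 -> Y <= p2 + q2 ->
  p1 ^+ 2 + p2 ^+ 2 = (t * D) ^+ 2 -> q1 ^+ 2 + q2 ^+ 2 = ((1 - t) * D) ^+ 2 ->
  X ^+ 2 + Y ^+ 2 = D ^+ 2 ->
  [/\ p1 = t * X, q1 = (1 - t) * X, p2 = t * Y & q2 = (1 - t) * Y].
Proof.
move=> t01 D0 p10 q10 X0 p20 q20 Y0 hX hY hp hq hD.
have cs : p1 * q1 + p2 * q2 <= t * (1 - t) * D ^+ 2.
  apply: ler_of_sqr; first by apply: mulr_ge0; [nra|exact: sqr_ge0].
  have -> : (t * (1 - t) * D ^+ 2) ^+ 2 = (t * D) ^+ 2 * ((1 - t) * D) ^+ 2 by ring.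
  rewrite -hp -hq -subr_ge0.
  have -> : (p1 ^+ 2 + p2 ^+ 2) * (q1 ^+ 2 + q2 ^+ 2) - (p1 * q1 + p2 * q2) ^+ 2 =
    (p1 * q2 - p2 * q1) ^+ 2 by ring.
  exact: sqr_ge0.
have X2 : X ^+ 2 <= (p1 + q1) ^+ 2 by apply: lerXn2r; rewrite ?nnegrE //; lra.
have Y2 : Y ^+ 2 <= (p2 + q2) ^+ 2 by apply: lerXn2r; rewrite ?nnegrE //; lra.
have eX : X = p1 + q1.
  by apply/eqP; rewrite eq_le hX /=; apply: ler_of_sqr => //; nra.
have eY : Y = p2 + q2.
  by apply/eqP; rewrite eq_le hY /=; apply: ler_of_sqr => //; nra.
have par : ((1 - t) * p1 - t * q1) ^+ 2 + ((1 - t) * p2 - t * q2) ^+ 2 <= 0.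
  have -> : ((1 - t) * p1 - t * q1) ^+ 2 + ((1 - t) * p2 - t * q2) ^+ 2 =
    (1 - t) ^+ 2 * (p1 ^+ 2 + p2 ^+ 2) + t ^+ 2 * (q1 ^+ 2 + q2 ^+ 2)
    - 2 * t * (1 - t) * (p1 * q1 + p2 * q2) by ring.
  rewrite hp hq.
  have e : p1 * q1 + p2 * q2 = t * (1 - t) * D ^+ 2.
    by apply/eqP; rewrite eq_le cs /= ; rewrite eX eY in hD; nra.
  by rewrite e le_eqVlt; apply/orP; left; apply/eqP; ring.
have e1 := sumsq_eq0 par; rewrite addrC in par; have e2 := sumsq_eq0 par.
by rewrite eX eY; split; lra.
Qed.

Lemma real_mid t (x y m : R) : 0 <= t <= 1 ->
  `|x - m| = t * `|x - y| -> `|m - y| = (1 - t) * `|x - y| ->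
  m = (1 - t) * x + t * y.
Proof.
move=> t01; case: (ger0P (x - y)) => h; case: (ger0P (x - m)) => h1;
case: (ger0P (m - y)) => h2; nra.
Qed.

Lemma minkowski2 (a b a' b' : R) : 0 <= a -> 0 <= a' ->
  Num.sqrt ((a + a') ^+ 2 + (b + b') ^+ 2) <=
  Num.sqrt (a ^+ 2 + b ^+ 2) + Num.sqrt (a' ^+ 2 + b' ^+ 2).
Proof.
move=> a0 a0'; set u := Num.sqrt (a ^+ 2 + _); set v := Num.sqrt (a' ^+ 2 + _).
have u0 : 0 <= u by exact: sqrtr_ge0.
have v0 : 0 <= v by exact: sqrtr_ge0.
have uE : u ^+ 2 = a ^+ 2 + b ^+ 2 by rewrite sqr_sqrtr // addr_ge0 ?sqr_ge0.
have vE : v ^+ 2 = a' ^+ 2 + b' ^+ 2 by rewrite sqr_sqrtr // addr_ge0 ?sqr_ge0.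
apply: ler_of_sqr; first by rewrite addr_ge0.
rewrite sqr_sqrtr; last by rewrite addr_ge0 ?sqr_ge0.
have : a * a' + b * b' <= u * v.
  apply: ler_of_sqr; first exact: mulr_ge0.
  rewrite exprMn uE vE -subr_ge0.
  have -> : (a ^+ 2 + b ^+ 2) * (a' ^+ 2 + b' ^+ 2) - (a * a' + b * b') ^+ 2 =
    (a * b' - b * a') ^+ 2 by ring.
  exact: sqr_ge0.
by nra.
Qed.

End Pythagoras.

Section Product.
Variables (R : realType) (M : Type) (d : M -> M -> R).
Hypothesis dxx : forall x, d x x = 0.
Hypothesis d_eq0 : forall x y, d x y = 0 -> x = y.
Hypothesis dC : forall x y, d x y = d y x.
Hypothesis d_tri : forall y x z, d x z <= d x y + d y z.
Let d_ge0 := dist_ge0 dxx dC d_tri.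

Variables (A P : set M) (pi : M -> M) (u : M -> R).
Hypotheses (piA : forall x, P x -> A (pi x)) (u_ge0 : forall x, P x -> 0 <= u x).
Hypothesis lift : forall a v, A a -> 0 <= v -> exists z, [/\ P z, pi z = a & u z = v].
Hypothesis dP : forall x y, P x -> P y ->
  d x y ^+ 2 = d (pi x) (pi y) ^+ 2 + (u x - u y) ^+ 2.

Lemma cat0_product : cat0 d A -> cat0 d P.
Proof.
move=> CA; split.
  move=> x y r Px Py r0.
  have [z|nz] := eqVneq (d x y) 0.
    by exists x; split=> //; rewrite ?dxx ?z; lra.
  have D0 : 0 < d x y by rewrite lt_def nz d_ge0.
  pose t := r / d x y; have rE : r = t * d x y by rewrite /t divfK.
  have t01 : 0 <= t <= 1 by apply/andP; split; [apply: divr_ge0; lra|rewrite ler_pdivrMr //; lra].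
  clearbody t; have [a Aa [a1 a2]] := tpt_exists dxx dC d_tri CA (piA Px) (piA Py) t01.
  have ux := u_ge0 Px; have uy := u_ge0 Py.
  have [|m [Pm mE um]] := lift (v := (1 - t) * u x + t * u y) Aa; first by nra.
  have D2 := dP Px Py.
  exists m; split=> //; rewrite rE.
    apply/eqP; rewrite -(eqrXn2 (n := 2)) ?d_ge0 //; last by rewrite -rE; lra.
    rewrite dP // mE a1 um !exprMn D2; apply/eqP; ring.
  have -> : d x y - t * d x y = (1 - t) * d x y by ring.
  apply/eqP; rewrite -(eqrXn2 (n := 2)) ?d_ge0 //; last by apply: mulr_ge0; lra.
  by rewrite dP // mE a2 um !exprMn D2; apply/eqP; ring.
move=> x y z m Px Py Pz Pm h.
have [e|nz] := eqVneq (d y z) 0.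
  have e1 : d y m = 0 by have := d_ge0 y m; have := d_ge0 m z; lra.
  have e2 : d m z = 0 by have := d_ge0 y m; have := d_ge0 m z; lra.
  by rewrite e e1 e2 !mul0r !addr0 subr0.
have D0 : 0 < d y z by rewrite lt_def nz d_ge0.
pose t := d y m / d y z; have tE : d y m = t * d y z by rewrite /t divfK.
have sE : d m z = (1 - t) * d y z by lra.
have t01 : 0 <= t <= 1.
  by rewrite /t divr_ge0 ?d_ge0 //= ler_pdivrMr //; have := d_ge0 m z; lra.
have [p1 q1 p2 q2] : [/\ d (pi y) (pi m) = t * d (pi y) (pi z),
    d (pi m) (pi z) = (1 - t) * d (pi y) (pi z),
    `|u y - u m| = t * `|u y - u z| & `|u m - u z| = (1 - t) * `|u y - u z| ].
  apply: (pythagoras_mid (D := d y z)) => //;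
    rewrite ?real_normK ?num_real // -?dP ?tE ?sE //.
  by rewrite (le_trans _ (ler_normD _ _)) // addrA subrK.
have S := tpt_stewart dxx d_eq0 dC d_tri CA (piA Px) (piA Py) (piA Pz) (piA Pm) t01
  (conj p1 q1).
have um := real_mid t01 p2 q2.
have -> : d m z * d x y ^+ 2 + d y m * d x z ^+ 2 - d y m * d m z * d y z =
  d y z * ((1 - t) * d x y ^+ 2 + t * d x z ^+ 2 - t * (1 - t) * d y z ^+ 2).
  by rewrite tE sE; ring.
by rewrite ler_pM2l // (dP Px Pm) (dP Px Py) (dP Px Pz) (dP Py Pz) um; lra.
Qed.

End Product.

(** * The intrinsic metric of tree space *)

Section TreeMetric.
Variables (R : realType) (p : nat).
Implicit Types (x y z : tree R p) (s t : split p).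

Lemma compat_refl s : compat s s.
Proof. by rewrite /compat subxx. Qed.

Lemma compatC s t : compat s t = compat t s.
Proof. by rewrite /compat disjoint_sym orbCA. Qed.

Definition clique (S : {set split p}) := [forall s in S, forall t in S, compat s t].

Lemma cliqueP (S : {set split p}) :
  reflect (forall s t, s \in S -> t \in S -> compat s t) (clique S).
Proof.
apply: (iffP 'forall_implyP) => H.
  by move=> s t sS tS; have /forall_inP := H s sS; apply.
by move=> s sS; apply/forall_inP => t tS; exact: H.
Qed.

Lemma maxcompat_extension (S : {set split p}) : clique S ->
  exists2 S', maxcompat S' & S \subset S'.
Proof.
move=> cS; have [S' /maxsetP[cS' maxS'] sub] := maxset_exists (P := clique) cS.
exists S' => //; apply/andP; split=> //; apply/forallP => t; apply/implyP => H.
have <- : t |: S' = S'; last by rewrite setU11.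
apply: maxS'; last exact: finset.subsetUr.
have /cliqueP cl := cS'; have /forall_inP Ht := H.
apply/cliqueP => a b /setU1P[->|aS] /setU1P[->|bS].
- exact: compat_refl.
- by rewrite compatC; exact: Ht.
- exact: Ht.
- exact: cl.
Qed.

Lemma tree_ge0 x s : 0 <= val x s.
Proof. by case: x => f /= /andP[/forallP]. Qed.

Lemma tree_compat x s t : val x s != 0 -> val x t != 0 -> compat s t.
Proof.
case: x => f /= /andP[_ /forallP H] hs ht.
by have /forallP/(_ t)/implyP := H s; apply; rewrite hs ht.
Qed.

Lemma tree_ext x y : (forall s, val x s = val y s) -> x = y.
Proof. by move=> h; apply: val_inj; apply/ffunP. Qed.

Lemma maxcompat_clique (S : {set split p}) : maxcompat S -> clique S.
Proof. by case/andP. Qed.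

Lemma same_orthantP x y : reflect
  (forall s t, (val x s != 0) || (val y s != 0) -> (val x t != 0) || (val y t != 0) ->
     compat s t) (same_orthant x y).
Proof.
apply: (iffP existsP).
  move=> [S /and3P[/maxcompat_clique/cliqueP cS /fintype.subsetP sx /fintype.subsetP sy]].
  by move=> s t hs ht; apply: cS; [move: hs|move: ht] => /orP[] h;
    first [by apply: sx; rewrite inE|by apply: sy; rewrite inE].
move=> H; have [|S mS sub] := @maxcompat_extension (supp x :|: supp y).
  by apply/cliqueP => s t; rewrite !inE; exact: H.
exists S; rewrite mS /= (fintype.subset_trans _ sub) ?finset.subsetUl //.
by rewrite (fintype.subset_trans _ sub) // finset.subsetUr.
Qed.

Lemma same_orthantC x y : same_orthant x y = same_orthant y x.
Proof. by apply: eq_existsb => S; rewrite (andbC (supp x \subset S)). Qed.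

Lemma same_orthant0 x : same_orthant x (origin R p).
Proof.
apply/same_orthantP => s t; rewrite !ffunE eqxx !orbF; exact: tree_compat.
Qed.

Lemma eucl_ge0 x y : 0 <= eucl x y.
Proof. exact: sqrtr_ge0. Qed.

Lemma euclC x y : eucl x y = eucl y x.
Proof. by congr Num.sqrt; apply: eq_bigr => s _; rewrite -sqrrN opprB. Qed.

Lemma sumsq_ge0 x y : 0 <= \sum_(s : split p) (val x s - val y s) ^+ 2.
Proof. by apply: sumr_ge0 => s _; exact: sqr_ge0. Qed.

Lemma coord_le_eucl x y s : `|val x s - val y s| <= eucl x y.
Proof.
apply: ler_of_sqr; first exact: eucl_ge0.
rewrite real_normK ?num_real // sqr_sqrtr ?sumsq_ge0 // (bigD1 s) //= lerDl.
by apply: sumr_ge0 => i _; exact: sqr_ge0.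
Qed.

Lemma eucl_le x y x' y' :
  (forall s, (val x s - val y s) ^+ 2 <= (val x' s - val y' s) ^+ 2) ->
  eucl x y <= eucl x' y'.
Proof. by move=> h; apply: ler_wsqrtr; apply: ler_sum => s _; exact: h. Qed.

Definition plen x (zs : seq (tree R p)) := \sum_(e <- pairmap (@eucl R p) x zs) e.

Lemma plen_cons x z zs : plen x (z :: zs) = eucl x z + plen z zs.
Proof. by rewrite /plen /= big_cons. Qed.

Lemma plen_nil x : plen x [::] = 0.
Proof. by rewrite /plen big_nil. Qed.

Lemma plen_ge0 x zs : 0 <= plen x zs.
Proof.
elim: zs x => [|z zs IH] x; first by rewrite plen_nil.
by rewrite plen_cons addr_ge0 ?eucl_ge0.
Qed.

Lemma plen_cat x zs zs' : plen x (zs ++ zs') = plen x zs + plen (last x zs) zs'.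
Proof.
elim: zs x => [|z zs IH] x; first by rewrite plen_nil add0r.
by rewrite cat_cons !plen_cons IH addrA.
Qed.

Let lens x y := [set l : R | exists zs : seq (tree R p),
  [/\ path (@same_orthant R p) x zs, last x zs = y & l = plen x zs]].

Let lens0 x y : lens x y !=set0.
Proof.
exists (plen x [:: origin R p; y]); exists [:: origin R p; y]; split=> //=.
by rewrite same_orthant0 same_orthantC same_orthant0.
Qed.

Let lens_lb x y : has_lbound (lens x y).
Proof. by exists 0 => _ [zs [_ _ ->]]; exact: plen_ge0. Qed.

Lemma tree_dist_le x y zs : path (@same_orthant R p) x zs -> last x zs = y ->
  tree_dist x y <= plen x zs.
Proof. by move=> h1 h2; apply: ge_inf (lens_lb x y) _ _; exists zs. Qed.

Lemma tree_dist_approx x y e : 0 < e -> exists zs,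
  [/\ path (@same_orthant R p) x zs, last x zs = y & plen x zs < tree_dist x y + e].
Proof.
move=> e0; have [] := inf_adherent e0 (conj (lens0 x y) (lens_lb x y)).
by move=> _ [zs [h1 h2 ->]] h; exists zs.
Qed.

Lemma tree_dist_eucl x y : same_orthant x y -> tree_dist x y <= eucl x y.
Proof.
move=> h; have := @tree_dist_le x y [:: y]; rewrite plen_cons plen_nil addr0.
by apply => //=; rewrite h.
Qed.

(* [tree_dist] is the largest pseudometric below [eucl] on each orthant. *)
Lemma le_tree_dist (D : tree R p -> tree R p -> R) :
  (forall x, D x x <= 0) -> (forall y x z, D x z <= D x y + D y z) ->
  (forall x y, same_orthant x y -> D x y <= eucl x y) ->
  forall x y, D x y <= tree_dist x y.
Proof.
move=> D0 Dtri De x y; apply: lb_le_inf; first exact: lens0.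
move=> _ [zs [h1 h2 ->]]; rewrite -/(plen x zs).
elim: zs x h1 h2 => [|z zs IH] x /=; first by move=> _ ->; rewrite plen_nil.
move=> /andP[xz pz] l; rewrite plen_cons; apply: le_trans (Dtri z _ _) _.
by apply: lerD; [exact: De|exact: IH].
Qed.

Lemma tree_dist_ge0 x y : 0 <= tree_dist x y.
Proof.
apply: (@le_tree_dist (fun _ _ => 0)) => // *; exact: eucl_ge0.
Qed.

Lemma tree_distxx x : tree_dist x x = 0.
Proof.
apply/eqP; rewrite eq_le tree_dist_ge0 andbT.
by have := @tree_dist_le x x [::]; rewrite plen_nil; apply.
Qed.

Lemma tree_dist_tri y x z : tree_dist x z <= tree_dist x y + tree_dist y z.
Proof.
apply/ler_addgt0Pr => e e0; have e2 : 0 < e / 2 by lra.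
have [zs [h1 h2 h3]] := tree_dist_approx x y e2.
have [zs' [h1' h2' h3']] := tree_dist_approx y z e2.
have := @tree_dist_le x z (zs ++ zs'); rewrite cat_path h1 last_cat h2 h1' plen_cat h2.
by move=> /(_ isT h2'); lra.
Qed.

Lemma tree_distC x y : tree_dist x y = tree_dist y x.
Proof.
suff H (a b : tree R p) : tree_dist b a <= tree_dist a b by apply/eqP; rewrite eq_le !H.
move: a b; apply: (@le_tree_dist (fun a b => tree_dist b a)) => [a|b a c|a b h].
- by rewrite tree_distxx.
- by rewrite addrC; exact: tree_dist_tri.
- by rewrite euclC; apply: tree_dist_eucl; rewrite same_orthantC.
Qed.

Lemma coord_lipschitz s x y : `|val x s - val y s| <= tree_dist x y.
Proof.
apply: (@le_tree_dist (fun x y => `|val x s - val y s|) _ _ _ x y) => {x y} [x|y x z|x y _].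
- by rewrite subrr normr0.
- by rewrite (le_trans _ (ler_normD _ _)) // addrA subrK.
- exact: coord_le_eucl.
Qed.

Lemma tree_dist_eq0 x y : tree_dist x y = 0 -> x = y.
Proof.
move=> h; apply: tree_ext => s; have := coord_lipschitz s x y; rewrite h normr_le0.
by rewrite subr_eq0 => /eqP.
Qed.

Definition proj_fun (W : {set split p}) x : {ffun split p -> R} :=
  [ffun s => if s \in W then val x s else 0].

Lemma proj_istree W x : istree (proj_fun W x).
Proof.
apply/andP; split; apply/forallP => s; first by rewrite ffunE; case: ifP => // _; exact: tree_ge0.
apply/forallP => t; rewrite !ffunE; apply/implyP.
case: (s \in W) => /=; last by rewrite eqxx.
case: (t \in W) => /=; last by rewrite eqxx andbF.
by move=> /andP[]; exact: tree_compat.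
Qed.

Definition proj W x : tree R p :=
  exist (fun f : {ffun split p -> R} => istree f) (proj_fun W x) (proj_istree W x).

Lemma projE W x s : val (proj W x) s = if s \in W then val x s else 0.
Proof. by rewrite ffunE. Qed.

Lemma proj_same_orthant W x y : same_orthant x y -> same_orthant (proj W x) (proj W y).
Proof.
move=> /same_orthantP h; apply/same_orthantP => s t; rewrite !projE.
case: (s \in W); last by rewrite eqxx.
by case: (t \in W); [exact: h|rewrite eqxx].
Qed.

Lemma proj_eucl W x y : eucl (proj W x) (proj W y) <= eucl x y.
Proof.
apply: eucl_le => s; rewrite !projE; case: (s \in W) => //.
by rewrite subrr expr0n /= sqr_ge0.
Qed.

Lemma plen_proj W x zs : plen (proj W x) (map (proj W) zs) <= plen x zs.
Proof.
elim: zs x => [|z zs IH] x; first by rewrite !plen_nil.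
by rewrite /= !plen_cons lerD ?proj_eucl.
Qed.

Lemma proj_lipschitz W x y : tree_dist (proj W x) (proj W y) <= tree_dist x y.
Proof.
apply: (@le_tree_dist (fun x y => tree_dist (proj W x) (proj W y)) _ _ _ x y)
  => {x y} [x|y x z|x y h]; first by rewrite tree_distxx.
  exact: tree_dist_tri.
by apply: le_trans (proj_eucl W x y); apply: tree_dist_eucl; exact: proj_same_orthant.
Qed.

Definition face (W : {set split p}) : set (tree R p) :=
  [set x : tree R p | forall s, s \notin W -> val x s = 0].

Lemma proj_face W x : face W (proj W x).
Proof. by move=> s; rewrite projE => /negbTE ->. Qed.

Lemma proj_id W x : face W x -> proj W x = x.
Proof.
by move=> h; apply: tree_ext => s; rewrite projE; case: ifPn => // /h ->.
Qed.

(** * The product structure around a split *)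

Section Star.
Variables (s : split p) (L : {set split p}).
Hypothesis sL : s \notin L.
Hypothesis compatL : forall t, t \in L -> compat s t.

Let P := face (s |: L).

Lemma star_compat x t : P x -> val x t != 0 -> compat s t.
Proof.
move=> Px; apply: contra_neqT => nc; apply: Px; rewrite !inE negb_or.
by apply/andP; split; apply: contraNN nc; [move=> /eqP ->; exact: compat_refl|exact: compatL].
Qed.

Definition lift_fun x (u : R) : {ffun split p -> R} :=
  [ffun t => if t == s then u else val x t].

Lemma lift_istree x u : P x -> 0 <= u -> istree (lift_fun x u).
Proof.
move=> Px u0; apply/andP; split; apply/forallP => t.
  by rewrite ffunE; case: ifP => // _; exact: tree_ge0.
apply/forallP => r; rewrite !ffunE; apply/implyP => /andP[].
case: (eqVneq t s) => [->|_]; case: (eqVneq r s) => [->|_].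
- by move=> _ _; exact: compat_refl.
- by move=> _; exact: star_compat.
- by move=> h _; rewrite compatC; exact: star_compat h.
- exact: tree_compat.
Qed.

Definition liftT x u : tree R p := insubd (origin R p) (lift_fun x u).

Lemma liftE x u t : P x -> 0 <= u -> val (liftT x u) t = if t == s then u else val x t.
Proof.
move=> Px u0; have -> : val (liftT x u) = lift_fun x u; last by rewrite ffunE.
by rewrite /liftT insubdK //; exact: lift_istree.
Qed.

Lemma lift_star x u : P x -> 0 <= u -> P (liftT x u).
Proof.
move=> Px u0 t tn; rewrite liftE //; case: eqP => [e|_]; last exact: Px.
by rewrite e !inE eqxx in tn.
Qed.

Lemma sub_star x : face L x -> P x.
Proof. by move=> h t; rewrite !inE negb_or => /andP[_ /h]. Qed.

Lemma eucl_sqr x y : eucl x y ^+ 2 = \sum_(t : split p) (val x t - val y t) ^+ 2.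
Proof. by rewrite sqr_sqrtr ?sumsq_ge0. Qed.

Lemma eucl_proj_sqr x y :
  eucl (proj L x) (proj L y) ^+ 2 + (val x s - val y s) ^+ 2 <= eucl x y ^+ 2.
Proof.
rewrite !eucl_sqr [leRHS](bigD1 s) //= [leRHS]addrC lerD2r (bigD1 s) //= !projE (negbTE sL).
rewrite subrr expr0n /= add0r; apply: ler_sum => t _; rewrite !projE.
by case: (t \in L) => //; rewrite subrr expr0n /= sqr_ge0.
Qed.

Lemma star_dist_ge x y :
  tree_dist (proj L x) (proj L y) ^+ 2 + (val x s - val y s) ^+ 2 <= tree_dist x y ^+ 2.
Proof.
pose D x y := Num.sqrt (tree_dist (proj L x) (proj L y) ^+ 2 + (val x s - val y s) ^+ 2).
have D2 a b : 0 <= tree_dist (proj L a) (proj L b) ^+ 2 + (val a s - val b s) ^+ 2.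
  by rewrite addr_ge0 ?sqr_ge0.
suff h : D x y <= tree_dist x y.
  rewrite -[leLHS]sqr_sqrtr //; apply: lerXn2r => //; rewrite nnegrE; [exact: sqrtr_ge0|exact: tree_dist_ge0].
apply: (@le_tree_dist D _ _ _ x y) => {x y} [x|y x z|x y h].
- by rewrite /D tree_distxx subrr expr0n /= addr0 sqrtr0.
- rewrite /D; apply: le_trans _ (minkowski2 _ _ (tree_dist_ge0 _ _) (tree_dist_ge0 _ _)).
  apply: ler_wsqrtr; apply: lerD; last by rewrite addrA subrK.
  apply: lerXn2r; rewrite ?nnegrE ?addr_ge0 ?tree_dist_ge0 //; exact: tree_dist_tri.
- apply: ler_of_sqr; first exact: eucl_ge0.
  rewrite sqr_sqrtr //; apply: le_trans (eucl_proj_sqr x y); rewrite lerD2r.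
  apply: lerXn2r; rewrite ?nnegrE ?eucl_ge0 ?tree_dist_ge0 //.
  by apply: tree_dist_eucl; exact: proj_same_orthant.
Qed.

Lemma lift_eucl x y u v : P x -> P y -> 0 <= u -> 0 <= v -> same_orthant x y ->
  tree_dist (liftT x u) (liftT y v) <= Num.sqrt (eucl x y ^+ 2 + (u - v) ^+ 2).
Proof.
move=> Px Py u0 v0 h; apply: le_trans (tree_dist_eucl _) _.
  have /same_orthantP H := h; apply/same_orthantP => t r; rewrite !liftE //.
  have cs a : (val x a != 0) || (val y a != 0) -> compat s a.
    by move=> /orP[]; exact: star_compat.
  case: (eqVneq t s) => [->|_]; case: (eqVneq r s) => [->|_] ht hr.
  - exact: compat_refl.
  - exact: cs.
  - by rewrite compatC; exact: cs.
  - exact: H.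
apply: ler_of_sqr; first exact: sqrtr_ge0.
rewrite [leRHS]sqr_sqrtr ?addr_ge0 ?sqr_ge0 // !eucl_sqr (bigD1 s) //= !liftE // eqxx addrC.
rewrite lerD2r [leRHS](bigD1 s) //= -[leLHS]add0r; apply: lerD; first exact: sqr_ge0.
by apply: ler_sum => t /negbTE ts; rewrite !liftE // ts.
Qed.

Lemma lift_path x zs u v : face L x -> 0 <= u -> 0 <= v ->
  path (@same_orthant R p) x zs -> (forall z, z \in zs -> face L z) ->
  tree_dist (liftT x u) (liftT (last x zs) v) <=
  Num.sqrt (plen x zs ^+ 2 + (u - v) ^+ 2).
Proof.
elim: zs x u => [|z zs IH] x u Fx u0 v0.
  move=> _ _; rewrite plen_nil /=.
  have := lift_eucl (sub_star Fx) (sub_star Fx) u0 v0 (introT (same_orthantP x x) _).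
  have -> : eucl x x = 0 by apply/eqP; rewrite -sqrf_eq0 eucl_sqr big1 // => i _; rewrite subrr expr0n.
  by apply => a b; rewrite !orbb; exact: tree_compat.
move=> /= /andP[xz pz] Fz; rewrite plen_cons.
have Fz1 : face L z by apply: Fz; rewrite mem_head.
have Fzs z' : z' \in zs -> face L z' by move=> h; apply: Fz; rewrite inE h orbT.
set l := eucl x z; set l' := plen z zs.
have l0 : 0 <= l by exact: eucl_ge0.
have l0' : 0 <= l' by exact: plen_ge0.
pose th := if l + l' == 0 then 0 else l / (l + l').
have th01 : 0 <= th <= 1.
  rewrite /th; case: eqVneq => [_|nz]; first by rewrite lexx ler01.
  have ps : 0 < l + l' by rewrite lt_def nz addr_ge0.
  by rewrite divr_ge0 ?addr_ge0 //= ler_pdivrMr //; lra.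
have thl : l = th * (l + l').
  rewrite /th; case: eqVneq => [z0|nz]; last by rewrite divfK.
  by rewrite mul0r; lra.
pose w := (1 - th) * u + th * v.
have w0 : 0 <= w by rewrite /w; nra.
have b1 := lift_eucl (sub_star Fx) (sub_star Fz1) u0 w0 xz.
have b2 := IH z w Fz1 w0 v0 pz Fzs.
apply: le_trans (tree_dist_tri (liftT z w) _ _) _; apply: le_trans (lerD b1 b2) _.
rewrite -/l -/l'; clearbody th; set K := l + l' in thl *.
have hl' : l' = (1 - th) * K by rewrite mulrBl mul1r -thl /K; ring.
have -> : l ^+ 2 + (u - w) ^+ 2 = th ^+ 2 * (K ^+ 2 + (u - v) ^+ 2).
  by rewrite thl /w; ring.
have -> : l' ^+ 2 + (w - v) ^+ 2 = (1 - th) ^+ 2 * (K ^+ 2 + (u - v) ^+ 2).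
  by rewrite hl' /w; ring.
rewrite (@sqrtrM _ (th ^+ 2)) ?sqr_ge0 // (@sqrtrM _ ((1 - th) ^+ 2)) ?sqr_ge0 //.
rewrite !sqrtr_sqr !ger0_norm; [|lra|lra].
by rewrite -mulrDl addrC subrK mul1r.
Qed.

Lemma lift_dist x y u v : face L x -> face L y -> 0 <= u -> 0 <= v ->
  tree_dist (liftT x u) (liftT y v) ^+ 2 <= tree_dist x y ^+ 2 + (u - v) ^+ 2.
Proof.
move=> Fx Fy u0 v0; rewrite leNgt; apply/negP; set D := tree_dist (liftT _ _) _ => h.
have h2 : 0 < D ^+ 2 - (u - v) ^+ 2 by have := sqr_ge0 (tree_dist x y); lra.
set q := Num.sqrt (D ^+ 2 - (u - v) ^+ 2).
have q0 : 0 <= q by exact: sqrtr_ge0.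
have qE : q ^+ 2 = D ^+ 2 - (u - v) ^+ 2 by rewrite sqr_sqrtr // ltW.
have lt : 0 < q - tree_dist x y.
  rewrite subr_gt0 ltNge; apply/negP => le.
  have : q ^+ 2 <= tree_dist x y ^+ 2 by apply: lerXn2r; rewrite ?nnegrE ?tree_dist_ge0.
  by lra.
have [zs [h1 h3 h4]] := tree_dist_approx x y lt.
pose zs' := map (proj L) zs.
have p1 : path (@same_orthant R p) x zs'.
  rewrite -(proj_id Fx) path_map; apply: sub_path h1 => a b.
  exact: proj_same_orthant.
have p2 : last x zs' = y by rewrite -(proj_id Fx) last_map h3 proj_id.
have p3 z : z \in zs' -> face L z by move=> /mapP[z' _ ->]; exact: proj_face.
have p4 : plen x zs' <= plen x zs.
  by rewrite -[X in plen X zs'](proj_id Fx); exact: plen_proj.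
have := lift_path Fx u0 v0 p1 p3; rewrite p2 -/D.
have pl0 := plen_ge0 x zs'.
have -> : D = Num.sqrt (q ^+ 2 + (u - v) ^+ 2).
  by rewrite qE subrK sqrtr_sqr ger0_norm // tree_dist_ge0.
rewrite ler_psqrt ?nnegrE ?addr_ge0 ?sqr_ge0 // lerD2r => le.
have : q <= plen x zs' by apply: ler_of_sqr.
by lra.
Qed.

Lemma star_dist x y : P x -> P y ->
  tree_dist x y ^+ 2 = tree_dist (proj L x) (proj L y) ^+ 2 + (val x s - val y s) ^+ 2.
Proof.
move=> Px Py; apply/eqP; rewrite eq_le star_dist_ge andbT.
have LE z : P z -> z = liftT (proj L z) (val z s).
  move=> Pz; apply: tree_ext => t.
  rewrite liftE ?tree_ge0 //; last by apply: sub_star; exact: proj_face.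
  case: eqP => [->//|ts]; rewrite projE; case: ifPn => // tL; apply: Pz.
  by rewrite !inE (negbTE tL) orbF; apply/eqP.
rewrite {1}(LE x Px) {1}(LE y Py); apply: lift_dist; rewrite ?tree_ge0 //; exact: proj_face.
Qed.

Lemma cat0_star : cat0 (@tree_dist R p) (face L) -> cat0 (@tree_dist R p) P.
Proof.
apply: (cat0_product tree_distxx tree_dist_eq0 tree_distC tree_dist_tri
  (pi := proj L) (u := fun x => val x s)).
- by move=> x _; exact: proj_face.
- by move=> x _; exact: tree_ge0.
- move=> a v Fa v0; exists (liftT a v); have Pa := sub_star Fa; split.
  + exact: lift_star.
  + rewrite -[RHS](proj_id Fa); apply: tree_ext => t; rewrite !projE.
    case: ifPn => // tL; rewrite liftE //; case: eqP => // e.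
    by rewrite e (negbTE sL) in tL.
  + by rewrite liftE // eqxx.
- exact: star_dist.
Qed.

End Star.
End TreeMetric.

(** * Curvature of tree space *)

Section TreeCat0.
Variables (R : realType) (p : nat).
Implicit Types (x y z : tree R p) (s t : split p).

Lemma eucl_le_sum x y : eucl x y <= \sum_(s : split p) `|val x s - val y s|.
Proof.
set T := \sum_s _.
have T0 : 0 <= T by apply: sumr_ge0.
apply: ler_of_sqr => //; rewrite eucl_sqr expr2 {1}/T mulr_suml.
apply: ler_sum => s _; rewrite -real_normK ?num_real // expr2 ler_wpM2l //.
by rewrite /T (bigD1 s) //= lerDl; apply: sumr_ge0.
Qed.

Definition orthant_fun (C : {set split p}) (v : split p -> R) : {ffun split p -> R} :=
  [ffun s => if s \in C then Num.max 0 (v s) else 0].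

Lemma orthant_istree C v : clique C -> istree (orthant_fun C v).
Proof.
move=> /cliqueP cC; apply/andP; split; apply/forallP => s.
  by rewrite ffunE; case: ifP => // _; rewrite le_max lexx.
apply/forallP => t; rewrite !ffunE; apply/implyP.
case: ifP => sC; last by rewrite eqxx.
by case: ifP => tC; [move=> _; exact: cC|rewrite eqxx andbF].
Qed.

Definition orthant_pt C v : tree R p := insubd (origin R p) (orthant_fun C v).

Lemma orthant_ptE C v s : clique C ->
  val (orthant_pt C v) s = if s \in C then Num.max 0 (v s) else 0.
Proof.
move=> cC; have -> : val (orthant_pt C v) = orthant_fun C v; last by rewrite ffunE.
by rewrite /orthant_pt insubdK //; exact: orthant_istree.
Qed.

Lemma max0_lipschitz (a b : R) : `|Num.max 0 a - Num.max 0 b| <= `|a - b|.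
Proof.
rewrite ler_norml; move: (ler_norm (a - b)) (ler_norm (b - a)); rewrite (distrC b a).
have := normr_ge0 (a - b).
by case: (leP 0 a); case: (leP 0 b) => *; lra.
Qed.

Lemma orthant_pt_dist C v w : clique C ->
  tree_dist (orthant_pt C v) (orthant_pt C w) <= \sum_s `|v s - w s|.
Proof.
move=> cC; apply: le_trans (tree_dist_eucl _) _.
  apply/same_orthantP => s t; rewrite !orthant_ptE //.
  case: ifP => sC; last by rewrite eqxx.
  by case: ifP => tC; [move=> _ _; exact: (cliqueP _ cC)|rewrite eqxx].
apply: le_trans (eucl_le_sum _ _) _; apply: ler_sum => s _; rewrite !orthant_ptE //.
by case: ifP => _; [exact: max0_lipschitz|rewrite subrr normr0].
Qed.

Lemma orthant_pt_id C x : clique C -> supp x \subset C ->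
  orthant_pt C (fun s => val x s) = x.
Proof.
move=> cC /fintype.subsetP sub; apply: tree_ext => s; rewrite orthant_ptE //.
case: ifPn => sC; first by rewrite max_r // tree_ge0.
by apply/esym/eqP; apply: contraNT sC => h; apply: sub; rewrite inE.
Qed.

Lemma clique_supp x : clique (supp x).
Proof. by apply/cliqueP => s t; rewrite !inE; exact: tree_compat. Qed.

Section Minimum.
Variables (L : {set split p}) (F : tree R p -> R) (k B : R).
Hypotheses (k0 : 0 <= k) (B0 : 0 <= B).
Hypothesis Flip : forall x y, `|F x - F y| <= k * tree_dist x y.
Hypothesis Fcoercive : forall x s, B < val x s -> F (origin R p) <= F x.

Lemma minimum_orthant C : clique C -> exists x, [/\ supp x \subset C &
  forall y, supp y \subset C -> F x <= F y].
Proof.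
move=> cC; pose n := #|{: split p}|.
pose pt (v : 'rV[R]_n) := orthant_pt C (fun s => v ord0 (enum_rank s)).
have sC v : supp (pt v) \subset C.
  apply/fintype.subsetP => s; rewrite inE orthant_ptE //.
  by case: ifP => //; rewrite eqxx.
pose f v := F (pt v).
have cf : continuous f.
  move=> v U /nbhs_ballP[e /= e0 sub].
  have K0 : 0 < k * n%:R + 1 by rewrite ltr_wpDl // mulr_ge0.
  change (nbhs v (f @^-1` U)).
  apply/nbhs_ballP; exists (e / (k * n%:R + 1)); first by rewrite /= divr_gt0.
  move=> w bw; apply: sub; rewrite /ball /=; apply: le_lt_trans (Flip _ _) _.
  have le : tree_dist (pt v) (pt w) <= n%:R * (e / (k * n%:R + 1)).
    apply: le_trans (orthant_pt_dist _ _ cC) _.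
    have -> : n%:R * (e / (k * n%:R + 1)) = \sum_(s : split p) (e / (k * n%:R + 1)).
      by rewrite sumr_const mulr_natl.
    apply: ler_sum => s _.
    by have := bw.2 ord0 (enum_rank s); rewrite /ball /= => /ltW.
  apply: le_lt_trans (ler_wpM2l k0 le) _.
  have q0 : 0 < e / (k * n%:R + 1) by exact: divr_gt0.
  have := divfK (lt0r_neq0 K0) e; set q := e / _ in q0 * => {1}<-.
  by lra.
pose A := [set v : 'rV[R]_n | forall i, `[0, B]%classic (v ord0 i)].
have A0 : A !=set0.
  by exists 0 => i /=; rewrite mxE in_itv /= lexx.
have cA : compact A by exact: (@rV_compact R n (fun=> `[0, B]%classic) (fun=> @segment_compact R 0 B)).
have [c cin cmin] := compact_EVT_min A0 cA (continuous_subspaceT cf).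
exists (pt c); split=> // y sy.
have [[s Bs]|nB] := pselect (exists s, B < val y s).
  apply: le_trans (Fcoercive Bs).
  have -> : origin R p = pt 0.
    apply: tree_ext => t; rewrite orthant_ptE // mxE maxxx ffunE.
    by case: ifP.
  by apply: cmin; rewrite inE => i /=; rewrite mxE in_itv /= lexx.
have -> : y = pt (\row_i val y (enum_val i)).
  rewrite -[LHS](orthant_pt_id cC sy); congr orthant_pt; apply/funext => s.
  by rewrite mxE enum_rankK.
apply: cmin; rewrite inE => i /=; rewrite mxE in_itv /= tree_ge0 /=.
by rewrite leNgt; apply/negP => h; apply: nB; exists (enum_val i).
Qed.

Lemma minimum_face : exists x, face L x /\ forall y, face L y -> F x <= F y.
Proof.
have faceE x : face L x <-> supp x \subset L.
  split=> [h|/fintype.subsetP h].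
    by apply/fintype.subsetP => s; rewrite inE; apply: contraNT => /h ->.
  by move=> s; apply: contraNeq => xs; apply: h; rewrite inE.
have H C : exists x, clique C -> supp x \subset C /\
    forall y, supp y \subset C -> F x <= F y.
  case: (boolP (clique C)) => [cC|_]; last by exists (origin R p).
  by have [x [h1 h2]] := minimum_orthant cC; exists x.
have [g gP] := choice H.
pose P (C : {set split p}) := clique C && (C \subset L).
have P0 : P finset.set0.
  by rewrite /P finset.sub0set andbT; apply/cliqueP => s t; rewrite inE.
case: (arg_minP (fun C => F (g C)) P0) => C /andP[cC CL] Cmin.
exists (g C); split.
  by apply/faceE; apply: fintype.subset_trans CL; exact: (gP C cC).1.
move=> y /faceE yL; apply: le_trans (Cmin (supp y) _) _.
  by rewrite /P clique_supp.
by apply: (gP (supp y) (clique_supp y)).2.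
Qed.

End Minimum.

Lemma path_cross s x zs : val x s = 0 -> path (@same_orthant R p) x zs ->
  (forall t, val (last x zs) t != 0 -> compat s t) ->
  exists b : tree R p, [/\ val b s = 0, (forall t, val b t != 0 -> compat s t) &
    tree_dist x b + tree_dist b (last x zs) <= plen x zs].
Proof.
elim: zs x => [|z zs IH] x xs px hl.
  by exists x; rewrite plen_nil !tree_distxx addr0.
have [xc|nc] := pselect (forall t, val x t != 0 -> compat s t).
  exists x; split=> //; rewrite tree_distxx add0r.
  by apply: tree_dist_le.
move: px hl => /= /andP[xz pz] hl.
have zs0 : val z s = 0.
  apply/eqP; apply: contra_notT nc => zs0 t xt.
  by have /same_orthantP := xz; apply; rewrite ?zs0 ?xt ?orbT.
have [b [b1 b2 b3]] := IH z zs0 pz hl.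
exists b; split=> //; rewrite plen_cons.
by have := tree_dist_tri z x b; have := tree_dist_eucl xz; lra.
Qed.

Lemma cross_attained (W : {set split p}) s x (q : tree R p) : s \notin W ->
  let L := W :&: finset (compat s) in
  face W x -> face (s |: L) q ->
  exists b, [/\ face W b, face (s |: L) b & tree_dist x b + tree_dist b q = tree_dist x q].
Proof.
move=> sW L Fx Fq.
have [||y1 y2|y t|b [Fb bmin]] := @minimum_face L (fun b => tree_dist x b + tree_dist b q)
    2 (tree_dist x (origin R p) + tree_dist (origin R p) q + \sum_t val x t).
- by [].
- by rewrite !addr_ge0 ?tree_dist_ge0 //; apply: sumr_ge0 => t _; exact: tree_ge0.
- have t1 := tree_dist_tri y1 x y2; have t2 := tree_dist_tri y2 x y1.
  have t3 := tree_dist_tri y1 y2 q; have t4 := tree_dist_tri y2 y1 q.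
  by rewrite (tree_distC y2 y1) in t2 t3; rewrite ler_norml; lra.
- move=> h; have c := coord_lipschitz t y x; rewrite (tree_distC y x) in c.
  have := ler_norm (val y t - val x t); have := tree_dist_ge0 y q.
  have : val x t <= \sum_t val x t.
    by rewrite (bigD1 t) //= lerDl; apply: sumr_ge0 => r _; exact: tree_ge0.
  by lra.
exists b; split.
- by move=> t tW; apply: Fb; rewrite !inE (negbTE tW).
- by move=> t; rewrite !inE negb_or => /andP[_] h; apply: Fb; rewrite !inE.
apply/eqP; rewrite eq_le tree_dist_tri andbT; apply/ler_addgt0Pr => e e0.
have [zs [h1 h2 h3]] := tree_dist_approx x q e0.
have [||b' [b1 b2 b3]] := path_cross (s := s) _ h1.
- exact: Fx.
- move=> t; rewrite h2; apply: contra_neqT => nc; apply: Fq.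
  rewrite !inE (negbTE nc) andbF orbF; apply: contraNN nc => /eqP ->.
  exact: compat_refl.
rewrite h2 in b3.
pose W1 := s |: W.
have Fpb : face L (proj W1 b').
  move=> t; rewrite !inE negb_and projE !inE; case: eqP => [->|_] /=; first by rewrite b1.
  case: ifP => //= tW nc.
  by apply/eqP; apply: contraNT nc; exact: b2.
have e1 : proj W1 x = x.
  by apply: proj_id => t; rewrite !inE negb_or => /andP[_]; exact: Fx.
have e2 : proj W1 q = q.
  apply: proj_id => t; rewrite !inE negb_or => /andP[ts tW]; apply: Fq.
  by rewrite !inE negb_or ts (negbTE tW).
have := bmin _ Fpb; have := proj_lipschitz W1 x b'; have := proj_lipschitz W1 b' q.
by rewrite e1 e2; lra.
Qed.

Lemma cat0_face (W : {set split p}) : cat0 (@tree_dist R p) (face W).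
Proof.
have [n] := ubnP #|W|; elim: n W => // n IH W; rewrite ltnS => cW.
have [->|[s sW]] := set_0Vmem W.
  have all0 x : face finset.set0 x -> x = origin R p.
    by move=> h; apply: tree_ext => t; rewrite h ?inE // ffunE.
  split.
    move=> x y r Fx Fy; rewrite (all0 x Fx) (all0 y Fy) tree_distxx => r0.
    exists (origin R p); rewrite tree_distxx; split; [|lra|lra].
    by move=> t _; rewrite ffunE.
  move=> x y z m Fx Fy Fz Fm _; rewrite (all0 x Fx) (all0 y Fy) (all0 z Fz) (all0 m Fm).
  by rewrite tree_distxx !mul0r subr0 addr0.
pose W' := W :\ s; have sW' : s \notin W' by rewrite !inE eqxx.
pose L := W' :&: finset (compat s).
have sL : s \notin L by rewrite !inE eqxx.
have cL t : t \in L -> compat s t by rewrite !inE => /andP[].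
have cardW' : (#|W'| < n)%N by apply: leq_trans cW; rewrite [leqRHS](cardsD1 s) sW.
have cardL : (#|L| < n)%N by apply: leq_ltn_trans cardW'; apply: subset_leq_card; exact: finset.subsetIl.
have -> : face W = face W' `|` face (s |: L) :> set (tree R p).
  apply/seteqP; split=> x /=.
    move=> Fx; have [xs|xs] := eqVneq (val x s) 0.
      by left=> t; rewrite !inE negb_and negbK => /orP[/eqP ->//|]; exact: Fx.
    right=> t; rewrite !inE negb_or => /andP[ts]; rewrite ts /= negb_and.
    case/orP; first exact: Fx.
    by move=> nc; apply/eqP; apply: contraNT nc; exact: tree_compat.
  move=> [Fx|Fx] t tW; apply: Fx; rewrite !inE (negbTE tW) ?andbF //= orbF.
  by apply: contraNneq tW => ->.
apply: (cat0_glue (@tree_distxx R p) (@tree_dist_eq0 R p) (@tree_distC R p) (@tree_dist_tri R p)).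
- exact: IH.
- exact: cat0_star sL cL (IH _ cardL).
- have -> : face W' `&` face (s |: L) = face L :> set (tree R p).
    apply/seteqP; split=> x /=.
      move=> [F1 F2] t tL; have [->|ts] := eqVneq t s; first exact: F1.
      by apply: F2; rewrite finset.inE negb_or finset.inE ts.
    move=> F; split=> t h; apply: F; first by rewrite finset.inE (negbTE h).
    by move: h; rewrite finset.inE negb_or => /andP[].
  exact: (IH _ cardL).1.
- by move=> x y Fx Fy; exact: cross_attained.
Qed.

Lemma tree_cat0 : cat0 (@tree_dist R p) [set: tree R p].
Proof.
suff <- : face [set: split p] = [set: tree R p] by exact: cat0_face.
by apply/seteqP; split=> // x _ s; rewrite inE.
Qed.

End TreeCat0.

(** * Log-concavity along geodesics *)

Section LogConcave.
Variables (R : realType) (p : nat).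
Notation T := (tree R p).
Notation d := (@tree_dist R p).
Implicit Types (x y z a b m : T) (g f h : T -> R).

Let dxx := @tree_distxx R p.
Let d_eq0 := @tree_dist_eq0 R p.
Let dC := @tree_distC R p.
Let d_tri := @tree_dist_tri R p.
Let CT := @tree_cat0 R p.

Lemma tree_tpt_exists t a b : 0 <= t <= 1 -> exists m, tpt d t a b m.
Proof.
by move=> t01; have [m _ h] := tpt_exists dxx dC d_tri CT (I : setT a) (I : setT b) t01; exists m.
Qed.

Lemma tree_tpt_uniq t a b m m' : tpt d t a b m -> tpt d t a b m' -> m = m'.
Proof. by apply: (tpt_uniq dxx d_eq0 dC d_tri CT). Qed.

Lemma tree_tpt_ratio s t a b m n : 0 <= s <= 1 -> 0 <= t <= 1 ->
  tpt d s a b m -> tpt d t a b n -> d m n = `|s - t| * d a b.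
Proof. by move=> s01 t01; apply: (tpt_ratio dxx d_eq0 dC d_tri CT). Qed.

Lemma tree_busemann t x y x' y' m m' : 0 <= t <= 1 ->
  tpt d t x y m -> tpt d t x' y' m' -> d m m' <= (1 - t) * d x x' + t * d y y'.
Proof. by move=> t01; apply: (busemann dxx d_eq0 dC d_tri CT). Qed.

Lemma face_convex (W : {set split p}) t x y m : 0 <= t <= 1 -> face W x -> face W y ->
  tpt d t x y m -> face W m.
Proof.
move=> t01 Fx Fy tm.
have [n Fn tn] := tpt_exists dxx dC d_tri (cat0_face R W) Fx Fy t01.
by rewrite (tree_tpt_uniq tm tn).
Qed.

Lemma coord_convex s t x y m : 0 <= t <= 1 -> tpt d t x y m ->
  val m s <= (1 - t) * val x s + t * val y s.
Proof.
move=> t01 tm; pose W := finset.setC (finset.set1 s).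
have dW z : d z (proj W z) <= val z s.
  apply: le_trans (tree_dist_eucl _) _.
    apply/same_orthantP => r r'; rewrite !projE.
    have E q : (val z q != 0) || ((if q \in W then val z q else 0) != 0) -> val z q != 0.
      by case/orP => //; case: ifP => //; rewrite eqxx.
    by move=> /E h /E h'; exact: tree_compat h h'.
  apply: ler_of_sqr; first exact: tree_ge0.
  rewrite eucl_sqr (bigD1 s) //= projE !inE eqxx /= subr0 big1 ?addr0 // => r rs.
  by rewrite projE !inE rs subrr expr0n.
have [n tn] := tree_tpt_exists (proj W x) (proj W y) t01.
have Fn := face_convex t01 (proj_face (W:=W) x) (proj_face (W:=W) y) tn.
have := tree_busemann t01 tm tn; have := coord_lipschitz s m n.
rewrite (Fn s) ?inE ?eqxx // subr0 ger0_norm ?tree_ge0 // => h1 h2.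
have := dW x; have := dW y => h3 h4.
by nra.
Qed.

Definition lconc g := forall t a b m, 0 <= t <= 1 -> tpt d t a b m ->
  0 < g a -> 0 < g b -> 0 < g m /\ (1 - t) * ln (g a) + t * ln (g b) <= ln (g m).

Lemma logE_ge (u r : R) : (u%:E <= logE r)%E -> 0 < r /\ u <= ln r.
Proof. by rewrite /logE; case: ifP => // r0; rewrite lee_fin. Qed.

Lemma prod_dist_sqr (u v : T * R) :
  prod_dist d u v ^+ 2 = d u.1 v.1 ^+ 2 + (u.2 - v.2) ^+ 2.
Proof. by rewrite sqr_sqrtr // addr_ge0 ?sqr_ge0. Qed.

Lemma lconc_of_log_concave g : log_concave g -> lconc g.
Proof.
move=> lc t a b m t01 tm ga gb.
set mu := ln (g a); set eta := ln (g b).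
set D := prod_dist d (a, mu) (b, eta).
have D0 : 0 <= D by exact: sqrtr_ge0.
have D2 : D ^+ 2 = d a b ^+ 2 + (mu - eta) ^+ 2 by rewrite prod_dist_sqr.
have [z|nz] := eqVneq D 0.
  have ab0 : d a b = 0.
    by apply: (@sumsq_eq0 _ _ (mu - eta)); rewrite -D2 z expr0n.
  have ab := d_eq0 ab0; have am : a = m by apply: d_eq0; rewrite tm.1 ab0 mulr0.
  by rewrite -am; split=> //; rewrite /eta -ab -/mu; lra.
have Dp : 0 < D by rewrite lt_def nz.
have H (s : R) : exists m, 0 <= s <= 1 -> tpt d s a b m.
  case: (boolP (0 <= s <= 1)) => [s01|_]; last by exists a.
  by have [n nP] := tree_tpt_exists a b s01; exists n.
have [ga' gaP] := choice H.
pose c r : T * R := (ga' (r / D), (1 - r / D) * mu + r / D * eta).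
have frac r : 0 <= r <= D -> 0 <= r / D <= 1.
  by move=> r01; apply/andP; split; [apply: divr_ge0; lra|rewrite ler_pdivrMr //; lra].
have cgeo : geodesic (prod_dist d) (a, mu) (b, eta) c.
  split; [|split].
  - have [e1 _] := gaP (0 / D) (frac 0 ltac:(lra)).
    rewrite /c mul0r subr0 mul1r mul0r addr0; congr pair.
    by symmetry; apply: d_eq0; rewrite mul0r mul0r in e1.
  - have [_ e1] := gaP (D / D) (frac D ltac:(lra)).
    rewrite -/D /c divff // in e1 *; rewrite subrr mul0r add0r mul1r; congr pair.
    by apply: d_eq0; rewrite e1 subrr mul0r.
  - move=> r s r01 s01.
    apply/eqP; rewrite -(eqrXn2 (n := 2)) ?sqrtr_ge0 //; apply/eqP.
    rewrite prod_dist_sqr /= (tree_tpt_ratio (frac r r01) (frac s s01) (gaP _ (frac r r01)) (gaP _ (frac s s01))).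
    rewrite exprMn !real_normK ?num_real //.
    transitivity (((r - s) / D) ^+ 2 * D ^+ 2); last by field.
    by rewrite D2; field.
have tD : 0 <= t * D <= prod_dist d (a, mu) (b, eta) by rewrite -/D; nra.
have := lc (a, mu) (b, eta) _ _ c cgeo (t * D) tD.
rewrite /hypograph /= /logE ga gb => /(_ (lexx _) (lexx _)).
rewrite mulfK // (tree_tpt_uniq (gaP t t01) tm).
by move/logE_ge.
Qed.

Lemma log_concave_of_lconc g : lconc g -> log_concave g.
Proof.
move=> lc [a mu] [b eta] /logE_ge /= [ga gmu] /logE_ge /= [gb geta] c [c0 [cD cgeo]] r r0.
set D := prod_dist d (a, mu) (b, eta) in cD cgeo r0.
have D0 : 0 <= D by exact: sqrtr_ge0.
have D2 : D ^+ 2 = d a b ^+ 2 + (mu - eta) ^+ 2 by rewrite prod_dist_sqr.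
have [z|nz] := eqVneq D 0.
  have -> : r = 0 by lra.
  by rewrite c0 /hypograph /= /logE ga lee_fin.
have Dp : 0 < D by rewrite lt_def nz.
pose t := r / D; have rE : r = t * D by rewrite /t divfK.
have t01 : 0 <= t <= 1.
  by apply/andP; split; [apply: divr_ge0; lra|rewrite ler_pdivrMr //; lra].
clearbody t.
have e1 := cgeo 0 r ltac:(lra) r0; have e2 := cgeo r D r0 ltac:(lra).
rewrite c0 in e1; rewrite cD in e2; case: (c r) e1 e2 => m ka e1 e2.
have p1 := congr1 (fun u : R => u ^+ 2) e1; have p2 := congr1 (fun u : R => u ^+ 2) e2.
rewrite /= prod_dist_sqr real_normK ?num_real //= in p1.
rewrite /= prod_dist_sqr real_normK ?num_real //= in p2.
have [q1 q2 q3 q4] : [/\ d a m = t * d a b, d m b = (1 - t) * d a b,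
    `|mu - ka| = t * `|mu - eta| & `|ka - eta| = (1 - t) * `|mu - eta| ].
  apply: (pythagoras_mid (D := D)) => //; rewrite ?tree_dist_ge0 ?real_normK ?num_real //.
  - by rewrite (le_trans _ (ler_normD _ _)) // addrA subrK.
  - by rewrite p1 rE; ring.
  - by rewrite p2 rE; ring.
have [gm le] := lc t a b m t01 (conj q1 q2) ga gb.
rewrite /hypograph /= /logE gm lee_fin (real_mid t01 q3 q4).
by apply: le_trans le; nra.
Qed.

Lemma lconcM f h : (forall x, 0 <= f x) -> (forall x, 0 <= h x) ->
  lconc f -> lconc h -> lconc (fun x => f x * h x).
Proof.
move=> f0 h0 lf lh t a b m t01 tm pa pb.
have pos x : 0 < f x * h x -> 0 < f x /\ 0 < h x.
  move=> h1; split; rewrite lt_def ?f0 ?h0 andbT; apply: contraTneq h1 => ->;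
  by rewrite ?mul0r ?mulr0 ltxx.
have [fa ha] := pos _ pa; have [fb hb] := pos _ pb.
have [fm lef] := lf t a b m t01 tm fa fb; have [hm leh] := lh t a b m t01 tm ha hb.
by split; [exact: mulr_gt0|rewrite !lnM ?posrE //; lra].
Qed.

Lemma ln_sqrt (u : R) : 0 < u -> ln (Num.sqrt u) = ln u / 2.
Proof.
move=> u0; rewrite -[in RHS](sqr_sqrtr (ltW u0)) expr2 lnM ?posrE ?sqrtr_gt0 //.
by field.
Qed.

Lemma lconc_sqrt f : lconc f -> lconc (fun x => Num.sqrt (f x)).
Proof.
move=> lf t a b m t01 tm; rewrite !sqrtr_gt0 => fa fb.
have [fm le] := lf t a b m t01 tm fa fb.
by split=> //; rewrite !ln_sqrt //; lra.
Qed.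

Lemma lconcZ f (c : R) : 0 < c -> lconc f -> lconc (fun x => f x / c).
Proof.
move=> c0 lf t a b m t01 tm; rewrite !pmulr_lgt0 ?invr_gt0 // => fa fb.
have [fm le] := lf t a b m t01 tm fa fb.
by split=> //; rewrite !ln_div ?posrE //; lra.
Qed.

Lemma lconc_expN (phi : T -> R) :
  (forall t a b m, 0 <= t <= 1 -> tpt d t a b m -> phi m <= (1 - t) * phi a + t * phi b) ->
  lconc (fun x => expR (- phi x)).
Proof.
move=> cv t a b m t01 tm _ _; split; first exact: expR_gt0.
by rewrite !expRK; have := cv t a b m t01 tm; lra.
Qed.

Lemma lconc_level f (c : R) : 0 < c -> lconc f -> forall t a b m, 0 <= t <= 1 ->
  tpt d t a b m -> c <= f a -> c <= f b -> c <= f m.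
Proof.
move=> c0 lf t a b m t01 tm fa fb.
have fa0 : 0 < f a by exact: lt_le_trans fa.
have fb0 : 0 < f b by exact: lt_le_trans fb.
have [fm le] := lf t a b m t01 tm fa0 fb0.
rewrite -ler_ln ?posrE //; apply: le_trans le.
move: fa fb; rewrite -[c <= f a]ler_ln ?posrE // -[c <= f b]ler_ln ?posrE // => fa fb.
by nra.
Qed.

Lemma uscM f h : (forall x, 0 <= f x) -> (forall x, 0 <= h x) ->
  usc f -> usc h -> usc (fun x => f x * h x).
Proof.
move=> f0 h0 uf uh x a lta.
have [e e0 le] : exists2 e, 0 < e & (f x + e) * (h x + e) < a.
  have Fx := f0 x; have Hx := h0 x.
  pose K := 1 + f x + h x; have K0 : 0 < K by rewrite /K; lra.
  pose q := (a - f x * h x) / (2 * K).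
  have q0 : 0 < q by rewrite divr_gt0 // ?subr_gt0 //; lra.
  have qE : q * (2 * K) = a - f x * h x by rewrite divfK // gt_eqF //; lra.
  exists (Num.min 1 q); first by rewrite lt_min ltr01.
  have m1 : Num.min 1 q <= 1 by rewrite ge_min lexx.
  have m2 : Num.min 1 q <= q by rewrite ge_min lexx orbT.
  have m0 : 0 < Num.min 1 q by rewrite lt_min ltr01.
  by move: m1 m2 m0; set e := Num.min _ _ => m1 m2 m0; rewrite /K in qE K0; nra.
have [e1 e10 h1] := uf x (f x + e) ltac:(lra).
have [e2 e20 h2] := uh x (h x + e) ltac:(lra).
exists (Num.min e1 e2); first by rewrite lt_min e10.
move=> y; rewrite lt_min => /andP[/h1 k1 /h2 k2].
apply: le_lt_trans le; apply: ler_pM => //; exact: ltW.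
Qed.

Lemma usc_sqrt f : (forall x, 0 <= f x) -> usc f -> usc (fun x => Num.sqrt (f x)).
Proof.
move=> f0 uf x a lta; have a0 : 0 < a by apply: le_lt_trans lta; exact: sqrtr_ge0.
have [|e e0 h] := uf x (a ^+ 2).
  rewrite -(sqr_sqrtr (f0 x)); rewrite ltr_pXn2r // nnegrE ?sqrtr_ge0 //.
  exact: ltW.
exists e => // y /h lt; rewrite -[a]ger0_norm ?ltW // -sqrtr_sqr ltr_sqrt //.
by rewrite exprn_gt0.
Qed.

Lemma uscZ f (c : R) : 0 < c -> usc f -> usc (fun x => f x / c).
Proof.
move=> c0 uf x a; rewrite ltr_pdivrMr // => /uf[e e0 h].
by exists e => // y /h; rewrite ltr_pdivrMr.
Qed.

Section DistSet.
Variable K : set T.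
Hypothesis K0 : K !=set0.

Definition dist_set x := inf [set d x k | k in K].

Let img0 x : [set d x k | k in K] !=set0.
Proof. by have [k Kk] := K0; exists (d x k); exists k. Qed.

Let img_lb x : has_lbound [set d x k | k in K].
Proof. by exists 0 => _ [k _ <-]; exact: tree_dist_ge0. Qed.

Lemma dist_set_ge0 x : 0 <= dist_set x.
Proof. by apply: lb_le_inf (img0 x) _ => _ [k _ <-]; exact: tree_dist_ge0. Qed.

Lemma dist_set_le x k : K k -> dist_set x <= d x k.
Proof. by move=> Kk; apply: ge_inf (img_lb x) _ _; exists k. Qed.

Lemma dist_set_approx x e : 0 < e -> exists2 k, K k & d x k < dist_set x + e.
Proof.
move=> e0; have [_ [k Kk <-] h] := inf_adherent e0 (conj (img0 x) (img_lb x)).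
by exists k.
Qed.

Lemma dist_set_in x : K x -> dist_set x = 0.
Proof.
by move=> Kx; apply/eqP; rewrite eq_le dist_set_ge0 andbT -(dxx x) dist_set_le.
Qed.

Lemma dist_set_lip x y : dist_set x <= dist_set y + d x y.
Proof.
apply/ler_addgt0Pr => e e0; have [k Kk h] := dist_set_approx y e0.
by have := dist_set_le x Kk; have := d_tri y x k; lra.
Qed.

Lemma dist_set_convex : (forall t a b m, 0 <= t <= 1 -> tpt d t a b m -> K a -> K b -> K m) ->
  forall t a b m, 0 <= t <= 1 -> tpt d t a b m ->
  dist_set m <= (1 - t) * dist_set a + t * dist_set b.
Proof.
move=> cK t a b m t01 tm; apply/ler_addgt0Pr => e e0.
have [ka Ka ha] := dist_set_approx a e0; have [kb Kb hb] := dist_set_approx b e0.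
have [n tn] := tree_tpt_exists ka kb t01.
have := dist_set_le m (cK _ _ _ _ t01 tn Ka Kb); have := tree_busemann t01 tm tn.
by nra.
Qed.

End DistSet.

Lemma usc_expN (phi : T -> R) : (forall x y, phi x <= phi y + d x y) ->
  usc (fun x => expR (- phi x)).
Proof.
move=> lip x a lta; have a0 : 0 < a by apply: lt_trans lta; exact: expR_gt0.
exists (ln a + phi x).
  by rewrite -ltrBlDr sub0r -ltr_expR lnK.
move=> y h; rewrite -[a]lnK ?posrE // ltr_expR; have := lip x y; lra.
Qed.

End LogConcave.

(** * Iterated integrals *)

Section IteratedIntegral.
Variable R : realType.
Notation mu := (@lebesgue_measure R).

Lemma intn_ge0 n (f : n.-tuple R -> \bar R) : (forall v, 0 <= f v)%E -> (0 <= intn f)%E.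
Proof.
elim: n f => [|n IH] f f0 /=; first exact: f0.
by apply: integral_ge0 => x _; apply: IH.
Qed.

Lemma eq_intn n (f g : n.-tuple R -> \bar R) : f =1 g -> intn f = intn g.
Proof. by move=> fg; congr intn; apply/funext. Qed.

Lemma measurable_intn n (d : measure_display) (T : measurableType d)
    (f : T * n.-tuple R -> \bar R) : (forall z, 0 <= f z)%E ->
  measurable_fun setT f -> measurable_fun setT (fun x => intn (fun v => f (x, v))).
Proof.
elim: n d T f => [|n IH] d T f f0 mf /=.
  by apply: (measurableT_comp mf); apply: measurable_fun_pair.
pose F (z : T * R) := intn (fun v => f (z.1, cons_tuple z.2 v)).
have mF : measurable_fun setT F.
  apply: (IH _ _ (fun zv : (T * R) * n.-tuple R => f (zv.1.1, cons_tuple zv.1.2 zv.2))) => //.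
  apply: (measurableT_comp mf); apply: measurable_fun_pair.
    by apply: measurableT_comp; exact: measurable_fst.
  apply: measurable_cons; last exact: measurable_snd.
  by apply: measurableT_comp; [exact: measurable_snd|exact: measurable_fst].
have F0 z : (0 <= F z)%E by apply: intn_ge0.
exact: (@measurable_fun_fubini_tonelli_F _ _ T _ R mu F mF F0).
Qed.

Lemma measurable_intn_cons n (f : n.+1.-tuple R -> \bar R) : (forall v, 0 <= f v)%E ->
  measurable_fun setT f -> measurable_fun setT (fun x : R => intn (fun v => f (cons_tuple x v))).
Proof.
move=> f0 mf.
apply: (@measurable_intn n _ _ (fun z : R * n.-tuple R => f (cons_tuple z.1 z.2))) => //.
apply: (measurableT_comp mf); apply: measurable_cons; [exact: measurable_fst|exact: measurable_snd].
Qed.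

Lemma measurable_cons_section n (f : n.+1.-tuple R -> \bar R) x :
  measurable_fun setT f -> measurable_fun setT (fun v => f (cons_tuple x v)).
Proof.
move=> mf; apply: (measurableT_comp mf); apply: measurable_cons => //; exact: measurable_id.
Qed.

Lemma intnD n (f g : n.-tuple R -> \bar R) :
  (forall v, 0 <= f v)%E -> (forall v, 0 <= g v)%E ->
  measurable_fun setT f -> measurable_fun setT g ->
  intn (fun v => f v + g v)%E = (intn f + intn g)%E.
Proof.
elim: n f g => [//|n IH] f g f0 g0 mf mg /=.
under eq_integral => x _.
  rewrite IH //; [|exact: measurable_cons_section|exact: measurable_cons_section].
  over.
rewrite ge0_integralD //.
- by move=> x _; apply: intn_ge0.
- exact: measurable_intn_cons.
- by move=> x _; apply: intn_ge0.
- exact: measurable_intn_cons.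
Qed.

Lemma intnZ n (k : R) (f : n.-tuple R -> \bar R) : 0 <= k ->
  (forall v, 0 <= f v)%E -> measurable_fun setT f ->
  intn (fun v => k%:E * f v)%E = (k%:E * intn f)%E.
Proof.
move=> k0; elim: n f => [//|n IH] f f0 mf /=.
under eq_integral => x _.
  rewrite IH //; last exact: measurable_cons_section.
  over.
rewrite ge0_integralZl //.
- exact: measurable_intn_cons.
- by move=> x _; apply: intn_ge0.
Qed.

Lemma le_intn n (f g : n.-tuple R -> \bar R) :
  (forall v, 0 <= f v)%E -> measurable_fun setT f -> measurable_fun setT g ->
  (forall v, f v <= g v)%E -> (intn f <= intn g)%E.
Proof.
elim: n f g => [|n IH] f g f0 mf mg fg /=; first exact: fg.
have g0 v : (0 <= g v)%E by exact: le_trans (fg v).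
apply: ge0_le_integral => //.
- by move=> x _; apply: intn_ge0.
- exact: measurable_intn_cons.
- exact: measurable_intn_cons.
- by move=> x _; apply: IH => //; exact: measurable_cons_section.
Qed.

Lemma intn_eq0_dominated n (u w : n.-tuple R -> \bar R) :
  (forall v, 0 <= u v)%E -> (forall v, 0 <= w v)%E ->
  measurable_fun setT u -> measurable_fun setT w ->
  (forall v, u v = 0 -> w v = 0)%E -> intn u = 0%E -> intn w = 0%E.
Proof.
elim: n u w => [|n IH] u w u0 w0 mu' mw uw /=; first exact: uw.
move=> iu0.
have mU := measurable_intn_cons u0 mu'; have mW := measurable_intn_cons w0 mw.
have /(ae_eq_integral_abs mu measurableT mU) ae : (\int[mu]_x `|intn (fun v => u (cons_tuple x v))| = 0)%E.
  by rewrite -[RHS]iu0; apply: eq_integral => x _; rewrite gee0_abs // intn_ge0.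
have ae' : ae_eq mu setT (fun x => intn (fun v => w (cons_tuple x v))) (cst 0%E).
  apply: filterS ae => x /= h _; apply: IH (h I) => //; try exact: measurable_cons_section.
  by move=> v; exact: uw.
have /(ae_eq_integral_abs mu measurableT mW) <- := ae'.
by apply: eq_integral => x _; rewrite gee0_abs // intn_ge0.
Qed.

Lemma intn_box n (K c : R) : 0 <= K -> 0 <= c ->
  intn (fun v : n.-tuple R => if `[< forall i, 0 < tnth v i <= K >] then c%:E else 0%E)
  = (c * K ^+ n)%:E.
Proof.
move=> K0 c0; elim: n => [|n IH] /=.
  by rewrite expr0 mulr1; case: asboolP => // h; exfalso; apply: h => -[].
transitivity (\int[mu]_(x in `]0%R, K]) cst (c * K ^+ n)%:E x)%E; last first.
  rewrite integral_cst //= lebesgue_measure_itv /= lte_fin.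
  case: ltP => K1; first by rewrite -EFinB -EFinM subr0 exprSr mulrA.
  have -> : K = 0 by lra.
  by rewrite mule0 expr0n /= mulr0.
rewrite [RHS]integral_mkcond; apply: eq_integral => x _; rewrite patchE.
have tc (y : R) (v : n.-tuple R) : (forall i, 0 < tnth (cons_tuple y v) i <= K) <->
    0 < y <= K /\ (forall i, 0 < tnth v i <= K).
  split=> [h|[h1 h2] i].
    by split=> [|i]; [have := h ord0; rewrite tnth0|have := h (lift ord0 i); rewrite tnthS].
  by case: (unliftP ord0 i) => [j|] ->; rewrite ?tnth0 ?tnthS.
case: ifPn; rewrite ?notin_setE ?inE /= in_itv /= => h.
  rewrite -IH; apply: eq_intn => v; congr (if _ then _ else _).
  by apply/asbool_equiv_eq; rewrite tc; tauto.
transitivity (intn (fun v : n.-tuple R => 0%E : \bar R)).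
  apply: eq_intn => v; case: asboolP => // /tc [h1 _].
  by case: h.
by elim: (n) => //= k IHk; rewrite integral0_eq.
Qed.

End IteratedIntegral.

Section Nu.
Variables (R : realType) (p : nat).
Notation T := (tree R p).
Implicit Types (S : {set split p}) (f g h u w : T -> R).

Definition ext S g (v : #|S|.-tuple R) : \bar R :=
  if `[< posorth v >] then (g (chart v))%:E else 0%E.

Lemma nu_intE g : nu_int g = (\sum_(S : {set split p} | maxcompat S) intn (@ext S g))%E.
Proof. by []. Qed.

Lemma measurable_posorth n : measurable (@posorth R n).
Proof.
have -> : @posorth R n = \bigcap_(i in [set: 'I_n]) ((fun v => tnth v i) @^-1` `]0%R, +oo[).
  apply/seteqP; split=> v /= h i; last by have := h i I; rewrite /= in_itv /= andbT.
  by move=> _; rewrite /= in_itv /= andbT; exact: h.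
apply: fin_bigcap_measurable; first exact: finite_finset.
move=> i _; rewrite -[X in measurable X]setTI.
by apply: (@measurable_tnth _ (measurableTypeR R) n i) => //; exact: measurable_itv.
Qed.

Definition ext_measurable g := forall S, maxcompat S -> measurable_fun setT (@ext S g).

Lemma nu_measurable_ext g : nu_measurable_fun g -> ext_measurable g.
Proof.
move=> mg S mS.
have -> : @ext S g = (EFin \o (fun v : #|S|.-tuple R => g (chart v))) \_ (@posorth R #|S|).
  apply/funext => v; rewrite /ext patchE; case: asboolP => h.
    by rewrite mem_set.
  by rewrite memNset.
apply/(measurable_restrictT _ (measurable_posorth (n := #|S|))).
by apply/measurable_EFinP; exact: mg.
Qed.

Lemma ext_ge0 S g v : (forall x, 0 <= g x) -> (0 <= @ext S g v)%E.
Proof. by move=> g0; rewrite /ext; case: ifP => // _; rewrite lee_fin. Qed.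

Lemma nu_int_ge0 g : (forall x, 0 <= g x) -> (0 <= nu_int g)%E.
Proof.
by move=> g0; apply: sume_ge0 => S _; apply: intn_ge0 => v; exact: ext_ge0.
Qed.

Lemma nu_intD f g : (forall x, 0 <= f x) -> (forall x, 0 <= g x) ->
  ext_measurable f -> ext_measurable g ->
  nu_int (fun x => f x + g x) = (nu_int f + nu_int g)%E.
Proof.
move=> f0 g0 mf mg; rewrite !nu_intE -big_split /=; apply: eq_bigr => S mS.
rewrite -intnD; first last.
- exact: mg.
- exact: mf.
- by move=> v; exact: ext_ge0.
- by move=> v; exact: ext_ge0.
by apply: eq_intn => v; rewrite /ext; case: ifP => // _; rewrite adde0.
Qed.

Lemma nu_intZ k g : 0 <= k -> (forall x, 0 <= g x) -> ext_measurable g ->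
  nu_int (fun x => k * g x) = (k%:E * nu_int g)%E.
Proof.
move=> k0 g0 mg; rewrite !nu_intE ge0_sume_distrr; last first.
  by move=> S _; apply: intn_ge0 => v; exact: ext_ge0.
apply: eq_bigr => S mS; rewrite -intnZ //; last 2 first.
- by move=> v; exact: ext_ge0.
- exact: mg.
by apply: eq_intn => v; rewrite /ext; case: ifP => // _; rewrite mule0.
Qed.

Lemma le_nu_int f g : (forall x, 0 <= f x) -> (forall x, f x <= g x) ->
  ext_measurable f -> ext_measurable g -> (nu_int f <= nu_int g)%E.
Proof.
move=> f0 fg mf mg; apply: lee_sum => S mS; apply: le_intn.
- by move=> v; exact: ext_ge0.
- exact: mf.
- exact: mg.
- by move=> v; case: ifP => // _; rewrite lee_fin.
Qed.

Lemma nu_int_eq0_dominated u w : (forall x, 0 <= u x) -> (forall x, 0 <= w x) ->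
  ext_measurable u -> ext_measurable w -> (forall x, u x = 0 -> w x = 0) ->
  nu_int u = 0%E -> nu_int w = 0%E.
Proof.
move=> u0 w0 mu' mw uw iu; rewrite nu_intE big1 // => S mS.
apply: (@intn_eq0_dominated _ _ (@ext S u)).
- by move=> v; exact: ext_ge0.
- by move=> v; exact: ext_ge0.
- exact: mu'.
- exact: mw.
- by move=> v; rewrite /ext; case: ifP => // _ [/uw ->].
- apply/eqP; rewrite eq_le intn_ge0 ?andbT; last by move=> v; exact: ext_ge0.
  rewrite -iu nu_intE (bigD1 S) //= leeDl //; apply: sume_ge0 => S' _.
  by apply: intn_ge0 => v; exact: ext_ge0.
Qed.

Lemma ext_measurable_indic (M : set T) : nu_measurable M -> ext_measurable (\1_M).
Proof.
move=> mM S mS.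
have -> : @ext S (\1_M) =
    EFin \o (\1_([set v : #|S|.-tuple R | posorth v /\ M (chart v)]) : _ -> R).
  apply/funext => v; rewrite /ext /= !indicE; case: asboolP => h.
    by congr (_%:R%:E); congr nat_of_bool; apply/idP/idP; rewrite !inE /=; tauto.
  by rewrite memNset //= => -[].
apply/measurable_EFinP; apply: measurable_indic; exact: mM.
Qed.

Definition crd S (v : #|S|.-tuple R) (s : split p) : R := nth 0 v (index s (enum S)).

Lemma chartE S (v : #|S|.-tuple R) : chart v = orthant_pt S (crd v).
Proof. by []. Qed.

Lemma measurable_crd S s : measurable_fun setT (fun v : #|S|.-tuple R => crd v s).
Proof.
case: (ltnP (index s (enum S)) #|S|) => h.
  have -> : (fun v : #|S|.-tuple R => crd v s) = (fun v => tnth v (Ordinal h)).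
    by apply/funext => v; rewrite (tnth_nth 0).
  exact: (@measurable_tnth _ (measurableTypeR R)).
have -> : (fun v : #|S|.-tuple R => crd v s) = cst 0; last exact: measurable_cst.
by apply/funext => v; rewrite /crd nth_default // size_tuple.
Qed.

Lemma chart_val S (v : #|S|.-tuple R) s : maxcompat S ->
  val (chart v) s = if s \in S then Num.max 0 (crd v s) else 0.
Proof. by move=> mS; rewrite chartE orthant_ptE //; exact: maxcompat_clique. Qed.

(* The sublevel sets of [phi] are countable unions of sublevel sets of the
   cones [v |-> phi q + |v - q|_1] with rational apex [q]. *)
Lemma lipschitz_nu_measurable (phi : T -> R) :
  (forall x y, phi x <= phi y + tree_dist x y) -> nu_measurable_fun phi.
Proof.
move=> lip S mS; apply: (@measurable_funTS _ _ _ (measurableTypeR R)) => _.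
pose cone (q : #|S|.-tuple rat) (v : #|S|.-tuple R) :=
  phi (chart (map_tuple ratr q)) + \sum_s `|crd v s - crd (map_tuple ratr q) s|.
have mcone q : measurable_fun setT (cone q).
  apply: measurable_funD; first exact: measurable_cst.
  apply: measurable_sum => s; apply: measurableT_comp; first exact: normr_measurable.
  by apply: measurable_funB; [exact: measurable_crd|exact: measurable_cst].
have dst (v w : #|S|.-tuple R) : tree_dist (chart v) (chart w) <= \sum_s `|crd v s - crd w s|.
  by rewrite !chartE; apply: orthant_pt_dist; exact: maxcompat_clique.
apply: (measurability _ (RGenInftyO.measurableE R)) => //.
move=> _ [_ [a ->] <-]; rewrite setTI.
have -> : (fun v : #|S|.-tuple R => phi (chart v)) @^-1` `]-oo, a[ =
    \bigcup_(q : #|S|.-tuple rat) (cone q @^-1` `]-oo, a[).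
  apply/seteqP; split=> v /=.
    rewrite in_itv /= => lta.
    pose N : R := #|{: split p}|%:R + 1.
    have N0 : 0 < N by rewrite /N ltr_wpDl.
    pose e := (a - phi (chart v)) / (2 * N).
    have e0 : 0 < e by rewrite divr_gt0 ?subr_gt0 // mulr_gt0.
    have H (i : 'I_#|S|) : exists q : rat, `|tnth v i - ratr q| < e.
      have [|q] := @rat_in_itvoo R (tnth v i - e) (tnth v i + e); first by lra.
      by rewrite in_itv /= => h; exists q; rewrite ltr_norml; lra.
    have [q qP] := choice H; exists (mktuple q) => //.
    have crde s : `|crd v s - crd (map_tuple ratr (mktuple q)) s| <= e.
      rewrite /crd; case: (ltnP (index s (enum S)) #|S|) => h.
        rewrite -!(tnth_nth _ _ (Ordinal h)) tnth_map tnth_mktuple; exact: ltW.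
      by rewrite !nth_default ?size_tuple // subrr normr0 ltW.
    rewrite /= in_itv /= /cone; set Sm := \sum_s _.
    have SmE : Sm <= #|{: split p}|%:R * e.
      rewrite mulr_natl -sumr_const; exact: ler_sum.
    have l1 := lip (chart (map_tuple ratr (mktuple q))) (chart v).
    have l2 := dst v (map_tuple ratr (mktuple q)); rewrite tree_distC in l1.
    have eE : e * (2 * N) = a - phi (chart v) by rewrite divfK // mulf_neq0 // gt_eqF.
    have : #|{: split p}|%:R * e < N * e by rewrite ltr_pM2r // ltrDl.
    rewrite -/Sm in l2.
    by move=> lt; lra.
  move=> [q _]; rewrite /= !in_itv /= /cone => h.
  by have := lip (chart v) (chart (map_tuple ratr q)); have := dst v (map_tuple ratr q); lra.
apply: countable_bigcupT_measurable => [|q].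
  exact: countableP.
by rewrite -[X in measurable X]setTI; apply: mcone => //; exact: measurable_itv.
Qed.

Lemma nu_measurable_funM f g : nu_measurable_fun f -> nu_measurable_fun g ->
  nu_measurable_fun (fun x => f x * g x).
Proof. by move=> mf mg S mS; apply: measurable_funM; [exact: mf|exact: mg]. Qed.

Lemma nu_measurable_funB f g : nu_measurable_fun f -> nu_measurable_fun g ->
  nu_measurable_fun (fun x => f x - g x).
Proof. by move=> mf mg S mS; apply: measurable_funB; [exact: mf|exact: mg]. Qed.

Lemma nu_measurable_comp (k : R -> R) f : measurable_fun setT k -> nu_measurable_fun f ->
  nu_measurable_fun (fun x => k (f x)).
Proof. by move=> mk mf S mS; apply: (measurableT_comp mk); exact: mf. Qed.

Lemma measurable_sqrt : measurable_fun setT (@Num.sqrt R).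
Proof. by apply: continuous_measurable_fun; exact: sqrt_continuous. Qed.

Lemma nu_measurable_neq f g : nu_measurable_fun f -> nu_measurable_fun g ->
  nu_measurable [set x | f x <> g x].
Proof.
move=> mf mg S mS.
have m0 : measurable (~` [set 0 : R]) by apply: measurableC; exact: measurable_set1.
have := nu_measurable_funB mf mg mS (measurable_posorth (n := #|S|)) m0.
suff -> : [set v : #|S|.-tuple R | posorth v /\ [set x | f x <> g x] (chart v)] =
  @posorth R #|S| `&` (fun v => f (chart v) - g (chart v)) @^-1` (~` [set 0]).
  by [].
apply/seteqP; split=> v /= [h1 h2]; split=> // e; apply: h2.
  by apply/eqP; rewrite -subr_eq0; apply/eqP.
by rewrite e subrr.
Qed.

End Nu.

(** * Maximum likelihood *)

Section MLE.
Variables (R : realType) (p : nat).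
Notation T := (tree R p).
Notation d := (@tree_dist R p).
Implicit Types (f g h : T -> R) (x y : T).

Definition maxcoord x : R := \big[Num.max/0]_s val x s.

Lemma maxcoord_le x (K : R) : 0 <= K -> (maxcoord x <= K) <-> (forall s, val x s <= K).
Proof.
move=> K0; split=> [h s|h]; last by apply: bigmax_le.
by apply: le_trans h; exact: le_bigmax.
Qed.

Lemma maxcoord_ge0 x : 0 <= maxcoord x.
Proof. exact: bigmax_ge_id. Qed.

Lemma maxcoord_lip x y : maxcoord x <= maxcoord y + d x y.
Proof.
apply/maxcoord_le => [|s]; first by rewrite addr_ge0 ?maxcoord_ge0 ?tree_dist_ge0.
have h : val y s <= maxcoord y by exact: le_bigmax.
have := coord_lipschitz s x y; have := ler_norm (val x s - val y s); lra.
Qed.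

Definition box (K : R) x : R := if maxcoord x <= K then 1 else 0.

Lemma box_ge0 K x : 0 <= box K x.
Proof. by rewrite /box; case: ifP. Qed.

Lemma box_measurable K : nu_measurable_fun (box K).
Proof.
apply: (@nu_measurable_comp _ _ (fun r => if r <= K then 1 else 0)); last first.
  by apply: lipschitz_nu_measurable; exact: maxcoord_lip.
have -> : (fun r => if r <= K then 1 else 0) = \1_(`]-oo, K]) :> (R -> R).
  apply/funext => r; rewrite indicE; case: ifPn => h.
    by rewrite mem_set //= in_itv.
  by rewrite memNset //= in_itv /=; exact/negP.
by apply: measurable_indic; exact: measurable_itv.
Qed.

Lemma box_usc K : usc (box K).
Proof.
move=> x a; rewrite /box; case: (leP (maxcoord x) K) => h lta.
  by exists 1 => // y _; case: ifP => // _; lra.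
exists (maxcoord x - K); first by lra.
by move=> y dy; have := maxcoord_lip x y; case: (leP (maxcoord y) K) => //; lra.
Qed.

Lemma box_lconc K : 0 <= K -> lconc (box K).
Proof.
move=> K0 t a b m t01 tm; rewrite /box.
case: ifP => [ha _|_]; last by rewrite ltxx.
case: ifP => [hb _|_]; last by rewrite ltxx.
have -> : maxcoord m <= K.
  apply/maxcoord_le => // s.
  have /maxcoord_le/(_ s) := ha; have /maxcoord_le/(_ s) := hb => /(_ K0) h1 /(_ K0) h2.
  by have := coord_convex s t01 tm; nra.
by rewrite ln1; split=> //; lra.
Qed.

Lemma box_nu_int K : 0 < K -> exists2 c : R, 0 < c & nu_int (box K) = c%:E.
Proof.
move=> K0; exists (\sum_(S : {set split p} | maxcompat S) K ^+ #|S|).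
  have cl0 : @clique p finset.set0 by apply/cliqueP => s t; rewrite inE.
  have [S mS _] := maxcompat_extension cl0.
  rewrite (bigD1 S) //= ltr_pwDl ?exprn_gt0 //; apply: sumr_ge0 => S' _.
  by rewrite exprn_ge0 // ltW.
rewrite nu_intE -sumEFin; apply: eq_bigr => S mS.
rewrite -[X in _ = X%:E]mul1r -intn_box ?ltW //; apply: eq_intn => v.
rewrite /ext /box; case: asboolP => [pv|npv]; last first.
  by case: asboolP => // h; case: npv => i; case/andP: (h i).
have -> : (maxcoord (chart v) <= K) = `[< forall i, 0 < tnth v i <= K >].
  apply/idP/asboolP => [/maxcoord_le h i|h].
    rewrite pv /=.
    have S_i : enum_val i \in S by exact: enum_valP.
    have idx : index (enum_val i) (enum S) = i.
      by rewrite /enum_val index_uniq ?enum_uniq // -cardE.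
    have := h (ltW K0) (enum_val i); rewrite chart_val // S_i /crd idx -tnth_nth.
    by rewrite max_r // ltW.
  apply/maxcoord_le => [|s]; first exact: ltW.
  rewrite chart_val //; case: ifP => sS; last exact: ltW.
  have lt : (index s (enum S) < #|S|)%N by rewrite cardE index_mem mem_enum.
  rewrite /crd -(tnth_nth 0 v (Ordinal lt)) ge_max ltW //=.
  by case/andP: (h (Ordinal lt)).
by case: ifP.
Qed.

Lemma F0bar_normalize g (c : R) : (forall x, 0 <= g x) -> nu_measurable_fun g ->
  nu_int g = c%:E -> 0 < c -> usc g -> lconc g -> F0bar (fun x => g x / c).
Proof.
move=> g0 mg ig c0 ug lg; split; last 2 first.
- exact: uscZ.
- by apply: log_concave_of_lconc; exact: lconcZ.
split.
- by move=> x; rewrite divr_ge0 // ltW.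
- by apply: (@nu_measurable_comp _ _ (fun r => r / c)) => //; apply: measurable_funM.
- have -> : (fun x => g x / c) = (fun x => c^-1 * g x) by apply/funext => x; rewrite mulrC.
  rewrite nu_intZ ?invr_ge0 ?ltW //; last exact: nu_measurable_ext.
  by rewrite ig -EFinM mulVf // gt_eqF.
Qed.

Section Sample.
Variables (n : nat) (X : 'I_n -> T).

Lemma loglik_fin g : (forall i, 0 < g (X i)) -> loglik X g = (\sum_(i < n) ln (g (X i)))%:E.
Proof.
by move=> h; rewrite /loglik -sumEFin; apply: eq_bigr => i _; rewrite /logE h.
Qed.

Lemma loglik_pos g (r : R) : (r%:E <= loglik X g)%E -> forall i, 0 < g (X i).
Proof.
move=> h i; rewrite ltNge; apply/negP => le; move: h.
have -> : loglik X g = -oo%E; last by [].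
by rewrite /loglik (bigD1 i) //= /logE ltNge le /= addNye.
Qed.

Lemma mle_pos f : is_mle X f -> forall i, 0 < f (X i).
Proof.
move=> [_ mf]; pose K : R := 1 + \sum_i maxcoord (X i).
have K0 : 0 < K by rewrite /K ltr_pwDl // sumr_ge0 // => i _; exact: maxcoord_ge0.
have [c c0 ic] := box_nu_int K0.
have Fb := F0bar_normalize (@box_ge0 K) (@box_measurable K) ic c0 (@box_usc K)
  (box_lconc (ltW K0)).
have bpos i : 0 < box K (X i) / c.
  rewrite /box; have -> : maxcoord (X i) <= K; last exact: divr_gt0.
  rewrite /K (bigD1 i) //= addrCA lerDl addr_ge0 // sumr_ge0 // => j _.
  exact: maxcoord_ge0.
have := mf _ Fb; rewrite (loglik_fin bpos); exact: loglik_pos.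
Qed.

(* The normalization constant [c] of a competitor adds [- n ln c] to its
   log-likelihood. *)
Lemma mle_mass f g (c : R) : (0 < n)%N -> is_mle X f ->
  (forall x, 0 <= g x) -> nu_measurable_fun g -> nu_int g = c%:E -> 0 < c ->
  usc g -> lconc g -> (forall i, 0 < g (X i)) ->
  \sum_(i < n) ln (f (X i)) <= \sum_(i < n) ln (g (X i)) -> 1 <= c.
Proof.
move=> n0 mf g0 mg ig c0 ug lg gX le.
have Fg := F0bar_normalize g0 mg ig c0 ug lg.
have gcX i : 0 < g (X i) / c by exact: divr_gt0.
have := mf.2 _ Fg; rewrite (loglik_fin gcX) (loglik_fin (mle_pos mf)) lee_fin.
under eq_bigr => i _ do rewrite ln_div ?posrE //.
rewrite big_split /= sumrN sumr_const card_ord => h.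
have : 0 <= ln c *+ n by lra.
by rewrite pmulrn_lge0 // => h'; rewrite -ler_ln ?posrE // ln1.
Qed.

Variables f1 f2 : T -> R.
Hypotheses (n0 : (0 < n)%N) (mle1 : is_mle X f1) (mle2 : is_mle X f2).

Let f1_ge0 x : 0 <= f1 x. Proof. by case: mle1 => -[[h]]. Qed.
Let f2_ge0 x : 0 <= f2 x. Proof. by case: mle2 => -[[h]]. Qed.
Let mf1 : nu_measurable_fun f1. Proof. by case: mle1 => -[[_ h]]. Qed.
Let mf2 : nu_measurable_fun f2. Proof. by case: mle2 => -[[_ h]]. Qed.
Let if1 : nu_int f1 = 1%E. Proof. by case: mle1 => -[[_ _ h]]. Qed.
Let if2 : nu_int f2 = 1%E. Proof. by case: mle2 => -[[_ _ h]]. Qed.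
Let uf1 : usc f1. Proof. by case: mle1 => -[]. Qed.
Let uf2 : usc f2. Proof. by case: mle2 => -[]. Qed.
Let lf1 : lconc f1. Proof. by case: mle1 => -[_ _ /lconc_of_log_concave]. Qed.
Let lf2 : lconc f2. Proof. by case: mle2 => -[_ _ /lconc_of_log_concave]. Qed.
Let p1 := mle_pos mle1.
Let p2 := mle_pos mle2.

Lemma nu_int_fin g : (forall x, 0 <= g x) -> (nu_int g <= 1)%E ->
  exists2 c : R, 0 <= c & nu_int g = c%:E.
Proof.
move=> g0 le; have := nu_int_ge0 g0.
by case: (nu_int g) le => [c|//|//] _; rewrite lee_fin => c0; exists c.
Qed.

(* Damping [f1] by the distance to a superlevel set of [f2] containing the sample
   would increase the likelihood, unless [f1] lives on that set. *)
Lemma mle_support : exists2 u : T -> R,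
  [/\ (forall x, 0 <= u x), nu_measurable_fun u & nu_int u = 0%E] &
  forall x, u x = 0 -> f2 x = 0 -> f1 x = 0.
Proof.
have [c c0 cX] : exists2 c : R, 0 < c & forall i, c <= f2 (X i).
  exists (\big[Num.min/1]_i f2 (X i)); last by move=> i; exact: bigmin_le_cond.
  by apply: lt_bigmin.
pose K := [set x | c <= f2 x].
have K0 : K !=set0 by exists (X (Ordinal n0)); exact: cX.
have cK t a b m : 0 <= t <= 1 -> tpt d t a b m -> K a -> K b -> K m.
  exact: lconc_level.
pose h x := expR (- dist_set K x).
have h0 x : 0 <= h x by exact: expR_ge0.
have h1 x : h x <= 1 by rewrite -expR0 ler_expR oppr_le0 dist_set_ge0.
have mh : nu_measurable_fun h.
  apply: (@nu_measurable_comp _ _ (fun r => expR (- r))).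
    by apply: measurableT_comp; [exact: measurable_expR|exact: oppr_measurable].
  by apply: lipschitz_nu_measurable; exact: dist_set_lip.
have lh : lconc h by apply: lconc_expN; exact: dist_set_convex.
have uh : usc h by apply: usc_expN; exact: dist_set_lip.
pose g x := f1 x * h x.
have g0 x : 0 <= g x by exact: mulr_ge0.
have mg : nu_measurable_fun g by exact: nu_measurable_funM.
have gf x : g x <= f1 x by rewrite /g ler_piMr.
have [b b0 ib] : exists2 b : R, 0 <= b & nu_int g = b%:E.
  apply: nu_int_fin => //; rewrite -if1; apply: le_nu_int => //; exact: nu_measurable_ext.
have bp : 0 < b.
  rewrite lt_def b0 andbT; apply/eqP => bz; rewrite bz in ib.
  have : nu_int f1 = 0%E.
    apply: (@nu_int_eq0_dominated _ _ g) => //; try exact: nu_measurable_ext.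
    by move=> x /eqP; rewrite mulf_eq0 (gt_eqF (expR_gt0 _)) orbF => /eqP.
  by rewrite if1 => /eqP; rewrite eqe oner_eq0.
have gX i : g (X i) = f1 (X i).
  by rewrite /g /h dist_set_in ?oppr0 ?expR0 ?mulr1 //; exact: cX.
have b1 : 1 <= b.
  apply: (mle_mass n0 mle1 g0 mg ib bp).
  - exact: uscM.
  - exact: lconcM.
  - by move=> i; rewrite gX; exact: p1.
  - by under [leRHS]eq_bigr do rewrite gX.
have m1 : nu_measurable_fun (fun x => f1 x - g x) by exact: nu_measurable_funB.
have s0 x : 0 <= f1 x - g x by rewrite subr_ge0.
exists (fun x => f1 x - g x).
  split=> //.
  have D := nu_intD g0 s0 (nu_measurable_ext mg) (nu_measurable_ext m1).
  have E : (fun x => g x + (f1 x - g x)) = f1 by apply/funext => x; rewrite addrC subrK.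
  rewrite E if1 ib in D.
  have := nu_int_ge0 s0; move: D; case: (nu_int _) => [r|//|//] /eqP.
  by rewrite eqe lee_fin => /eqP D r0; congr EFin; lra.
move=> x /eqP; rewrite subr_eq0 => /eqP fg f20.
apply/eqP; apply/negPn/negP => f1n.
have hx : h x = 1.
  by apply/eqP; rewrite -(inj_eq (mulfI f1n)) mulr1; apply/eqP/esym.
have dz : dist_set K x = 0.
  by move: hx; rewrite /h -[in RHS]expR0 => /expR_inj /eqP; rewrite oppr_eq0 => /eqP.
have [e e0 he] := uf2 (x := x) (a := c) ltac:(by rewrite f20).
have [k Kk] := dist_set_approx K0 x e0; rewrite dz add0r => /he.
by rewrite ltNge Kk.
Qed.

Lemma mle_unique : nu_ae (fun x => f1 x = f2 x).
Proof.
pose w x := Num.sqrt (f1 x) * Num.sqrt (f2 x).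
have sq1 x : Num.sqrt (f1 x) ^+ 2 = f1 x by exact: sqr_sqrtr.
have sq2 x : Num.sqrt (f2 x) ^+ 2 = f2 x by exact: sqr_sqrtr.
have w0 x : 0 <= w x by rewrite mulr_ge0 // sqrtr_ge0.
have ms1 : nu_measurable_fun (fun x => Num.sqrt (f1 x)).
  by apply: nu_measurable_comp => //; exact: measurable_sqrt.
have ms2 : nu_measurable_fun (fun x => Num.sqrt (f2 x)).
  by apply: nu_measurable_comp => //; exact: measurable_sqrt.
have mw : nu_measurable_fun w by exact: nu_measurable_funM.
pose v x := (Num.sqrt (f1 x) - Num.sqrt (f2 x)) * (Num.sqrt (f1 x) - Num.sqrt (f2 x)).
have v0 x : 0 <= v x by rewrite /v -expr2 sqr_ge0.
have mv : nu_measurable_fun v by apply: nu_measurable_funM; exact: nu_measurable_funB.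
have m2w : nu_measurable_fun (fun x => 2 * w x).
  by apply: (@nu_measurable_comp _ _ (fun r => 2 * r)) => //; apply: measurable_funM.
have w20 x : 0 <= 2 * w x by rewrite mulr_ge0.
have total : (2%:E * nu_int w + nu_int v = 2%:E)%E.
  rewrite -nu_intZ //; last exact: nu_measurable_ext.
  rewrite -nu_intD //; try exact: nu_measurable_ext.
  have -> : (fun x => 2 * w x + v x) = (fun x => f1 x + f2 x).
    by apply/funext => x; rewrite /w /v -[in RHS](sq1 x) -[in RHS](sq2 x); ring.
  rewrite nu_intD //; try exact: nu_measurable_ext.
  by rewrite if1 if2 -EFinD.
have [c cE] : exists c : R, nu_int w = c%:E.
  have := nu_int_ge0 w0; have := nu_int_ge0 v0; move: total.
  case: (nu_int w) => [c|//|//]; first by move=> *; exists c.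
  by case: (nu_int v) => [r|//|//]; rewrite mulry gtr0_sg // mul1e.
have c0 : 0 <= c by have := nu_int_ge0 w0; rewrite cE lee_fin.
have cp : 0 < c.
  rewrite lt_def c0 andbT; apply/eqP => cz; rewrite cz in cE.
  have [u [u0 mu iu] uf] := mle_support.
  have : nu_int f1 = 0%E.
    apply: (@nu_int_eq0_dominated _ _ (fun x => u x + w x)) => //.
    - by move=> x; rewrite addr_ge0.
    - by apply: nu_measurable_ext => S mS; apply: measurable_funD; [exact: mu|exact: mw].
    - exact: nu_measurable_ext.
    - move=> x uw; have ux : u x = 0 by have := u0 x; have := w0 x; lra.
      have : w x = 0 by lra.
      move=> /eqP; rewrite mulf_eq0 => /orP[] /eqP z.
        by rewrite -sq1 z expr0n.
      by apply: uf => //; rewrite -sq2 z expr0n.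
    - by rewrite nu_intD //; [rewrite iu cE adde0|exact: nu_measurable_ext|exact: nu_measurable_ext].
  by rewrite if1 => /eqP; rewrite eqe oner_eq0.
have wX i : 0 < w (X i) by rewrite mulr_gt0 // sqrtr_gt0; [exact: p1|exact: p2].
have eqL : \sum_(i < n) ln (f1 (X i)) = \sum_(i < n) ln (f2 (X i)).
  apply/eqP; rewrite eq_le -2!lee_fin -(loglik_fin p1) -(loglik_fin p2).
  by rewrite mle1.2 ?mle2.2 //; [case: mle1|case: mle2].
have c1 : 1 <= c.
  apply: (mle_mass n0 mle1 w0 mw cE cp) => //.
  - by apply: uscM; (try by move=> x; exact: sqrtr_ge0); exact: usc_sqrt.
  - by apply: lconcM; (try by move=> x; exact: sqrtr_ge0); exact: lconc_sqrt.
  - have -> : \sum_(i < n) ln (w (X i)) =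
      (\sum_(i < n) ln (f1 (X i)) + \sum_(i < n) ln (f2 (X i))) / 2.
      rewrite -big_split /= mulr_suml; apply: eq_bigr => i _.
      have q1 := p1 i; have q2 := p2 i.
      by rewrite lnM ?posrE ?sqrtr_gt0 // !ln_sqrt // -mulrDl.
    by rewrite -eqL; lra.
have iv : nu_int v = 0%E.
  have := nu_int_ge0 v0; move: total; rewrite cE.
  case: (nu_int v) => [r|//|//] /eqP; rewrite -EFinM -EFinD eqe lee_fin => /eqP t r0.
  by congr EFin; lra.
exists [set x | f1 x <> f2 x]; split=> //.
  exact: nu_measurable_neq.
apply: (@nu_int_eq0_dominated _ _ v) => //.
- exact: nu_measurable_ext.
- by apply: ext_measurable_indic; exact: nu_measurable_neq.
move=> x /eqP; rewrite mulf_eq0 orbb subr_eq0 => /eqP e.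
by rewrite indicE memNset //=; apply; rewrite -sq1 -sq2 e.
Qed.

End Sample.
End MLE.

Theorem theorem4 (R : realType) (p n : nat) (X : 'I_n -> tree R p)
  (f1 f2 : tree R p -> R) :
  (1 <= p)%N -> (1 <= n)%N ->
  is_mle X f1 -> is_mle X f2 ->
  nu_ae (fun x => f1 x = f2 x).
Proof. by move=> _ n0; exact: mle_unique. Qed.
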